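(* Let $D>1$ be squarefree and $F=\mathbb{Q}(\sqrt D)$. If there exists a universal ternary quadratic $\mathcal{O}_F$-lattice, then $D\in\{2,3,5,6,7,10,13,17,21,33,41,65,77\}$. Furthermore, for $D=10$ and $D=65$ there exists no free universal ternary quadratic $\mathcal{O}_F$-lattice.
   Context: $\mathcal{O}_F^+$ is the set of totally positive elements of $\mathcal{O}_F$. A quadratic $\mathcal{O}_F$-lattice is a finitely generated $\mathcal{O}_F$-submodule $L$ of a quadratic space $(V,Q)$ over $F$ with $Q(L)\subseteq\mathcal{O}_F$ (not necessarily classical); ternary means $\dim_F FL=3$; free means free as an $\mathcal{O}_F$-module. $L$ is universal if $Q(v)\in\mathcal{O}_F^+$ for all nonzero $v\in L$ and $Q(L\setminus\{0\})=\mathcal{O}_F^+$. *)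

(* Defs.v *)
From HB Require Import structures.
From mathcomp Require Import all_boot all_order all_algebra all_field.
From mathcomp Require Import classical_sets.

Set Implicit Arguments.
Unset Strict Implicit.
Unset Printing Implicit Defensive.

Import Order.TTheory GRing.Theory Num.Theory.

Local Open Scope classical_set_scope.
Local Open Scope ring_scope.

Definition squarefree (n : nat) : Prop :=
  forall d : nat, (d ^ 2 %| n)%N -> d = 1%N.

Section NumberField.
Variable F : fieldExtType rat.

Definition ring_of_integers : set F :=
  [set x | integralOver (intr : int -> F) x].

(* The order on algC is partial: 0 < z means that z is real and positive.
   Hence this is total positivity for totally real F; an F with a non-real
   embedding has no totally positive element in this sense. *)
Definition totally_positive (x : F) : Prop :=
  forall sigma : {rmorphism F -> algC}, 0 < sigma x.

Definition totally_positive_integers : set F :=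
  ring_of_integers `&` [set x | totally_positive x].

Variable V : vectType F.

Definition quadratic_form (Q : V -> F) : Prop :=
  (forall (a : F) (v : V), Q (a *: v) = a ^+ 2 * Q v) /\
  (exists B : {biscalar V}, forall u v : V, Q (u + v) = Q u + Q v + B u v).

Definition integer_span (n : nat) (e : 'I_n -> V) : set V :=
  [set v | exists2 a : 'I_n -> F,
     (forall i, ring_of_integers (a i)) & v = \sum_(i < n) a i *: e i].

Definition integer_free (n : nat) (e : 'I_n -> V) : Prop :=
  forall a : 'I_n -> F, (forall i, ring_of_integers (a i)) ->
    \sum_(i < n) a i *: e i = 0 -> forall i, a i = 0.

(* Finitely generated submodules are exactly the spans of finite families. *)
Definition quadratic_lattice (Q : V -> F) (L : set V) : Prop :=
  [/\ quadratic_form Q,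
      exists (n : nat) (e : 'I_n -> V), L = integer_span e
    & Q @` L `<=` ring_of_integers].

(* U is FL, the least F-subspace containing L. *)
Definition field_span (L : set V) (U : {vspace V}) : Prop :=
  L `<=` [set v | v \in U] /\
  (forall W : {vspace V}, L `<=` [set v | v \in W] -> (U <= W)%VS).

Definition ternary (L : set V) : Prop :=
  exists2 U : {vspace V}, field_span L U & \dim U = 3%N.

(* A basis of a finitely generated module over a nonzero commutative ring is
   finite, so finite bases suffice. *)
Definition free_lattice (L : set V) : Prop :=
  exists (n : nat) (e : 'I_n -> V), L = integer_span e /\ integer_free e.

Definition universal (Q : V -> F) (L : set V) : Prop :=
  (forall v, L v -> v != 0 -> totally_positive_integers (Q v)) /\
  Q @` (L `\ 0) = totally_positive_integers.

End NumberField.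

(* Main.v *)
(** Let Z[w] be the ring of integers of F and B the polar form of Q, and fix v1, v2 in L
    with Q v1 = 1 and Q v2 = a2. The complement of the plane <v1, v2> in FL is a line,
    spanned by a vector N of L built from a third vector v3. Hence, if h(v) is half the Gram
    determinant of v1, v2, v, then B(N, v)^2 = 4 h(v3) h(v) for all v in L. Cauchy-Schwarz
    leaves finitely many pairings of v with v1, v2, v3 when Q v is given, so a finite search
    shows that some totally positive integer is missed by L. This settles D < 961 if D = 1
    mod 4 and D < 225 otherwise.

    For larger D a nonrational integer is too large to be a pairing between vectors of values
    1, 2 and 3 (or 5), or between one of these and a vector v whose value is the least totally
    positive element of w + Z. The three vectors span FL and have a rational Gram matrix, so
    Q v would be rational.

    If L is free, then h(v3) = d^2 h0, where h0 belongs to a basis of L and d in Z[w] is the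
    determinant of (v1, v2, v3) in that basis. For D = 10 and D = 65 all norms are 0, 1 or
    -1 mod 5, which often forces d to be a unit. Then v1, v2, v3 is itself a basis, so B(N, v3)
    divides B(N, v) for all v in L, and with this extra condition the search succeeds. *)

Require Import Defs.
From HB Require Import structures.
From Stdlib Require Import ZArith.
From mathcomp Require Import all_boot all_order all_algebra all_field.
From mathcomp Require Import classical_sets.
From mathcomp Require Import zify ring ssrZ.

Set Implicit Arguments.
Unset Strict Implicit.
Unset Printing Implicit Defensive.

Import Order.TTheory GRing.Theory Num.Theory.

Local Open Scope classical_set_scope.
Local Open Scope ring_scope.

Delimit Scope Z_scope with BZ.

Local Arguments Z.mul : simpl never.
Local Arguments Z.add : simpl never.
Local Arguments Z.sub : simpl never.
Local Arguments Z.opp : simpl never.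
Local Arguments Z.modulo : simpl never.
Local Arguments Z.div : simpl never.
Local Arguments Z.sqrt : simpl never.

(** * Integers of a quadratic field as pairs *)

(** The search computes with binary integers; this map carries them through [int] into any ring. *)
Definition zR (R : pzRingType) (z : Z) : R := (int_of_Z z)%:~R.

Section zR.
Variable R : pzRingType.
Implicit Types x y : Z.

Lemma zRD x y : zR R (x + y)%BZ = zR R x + zR R y.
Proof. by rewrite /zR -rmorphD -rmorphD. Qed.

Lemma zRN x : zR R (- x)%BZ = - zR R x.
Proof. by rewrite /zR -rmorphN -rmorphN. Qed.

Lemma zRB x y : zR R (x - y)%BZ = zR R x - zR R y.
Proof. by rewrite -zRN -zRD. Qed.

Lemma zRM x y : zR R (x * y)%BZ = zR R x * zR R y.
Proof. by rewrite /zR -rmorphM -rmorphM. Qed.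

Lemma zR_2 : zR R 2%BZ = 2.
Proof. by []. Qed.

Lemma zR_4 : zR R 4%BZ = 4.
Proof. by []. Qed.
End zR.

Lemma zR_ge0 (R : numDomainType) x : (0 <= zR R x) = (0 <=? x)%BZ.
Proof. rewrite /zR ler0z. lia. Qed.

Lemma zR_real (R : numDomainType) x : zR R x \is Num.real.
Proof. exact: realz. Qed.

Lemma zR_gt0 (R : numDomainType) x : (0 < zR R x) = (0 <? x)%BZ.
Proof. rewrite /zR ltr0z. lia. Qed.

Lemma zR_eq0 (R : numDomainType) x : (zR R x == 0) = (x =? 0)%BZ.
Proof. rewrite /zR intr_eq0. lia. Qed.

Lemma zR_nat (R : pzRingType) k : zR R (Z.of_nat k) = k%:R.
Proof. by rewrite /zR pmulrn; congr (_%:~R); lia. Qed.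

Lemma zR_inj : injective (zR rat).
Proof.
move=> a b /eqP; rewrite -subr_eq0 -zRB zR_eq0 => /Z.eqb_spec; lia.
Qed.

Lemma rat_int_zR (q : rat) : q \is a Num.int -> exists k : Z, q = zR rat k.
Proof. by case/intrP => k ->; exists (Z_of_int k); rewrite /zR Z_of_intK. Qed.

(** * The search procedure on pairs of integers *)

Section Checker.
Local Open Scope Z_scope.

(* The pair (x, y) stands for x + y w, where w^2 = t w + n. *)
Definition elt : Type := Z * Z.

Variables t n : Z.

Definition qadd (x y : elt) : elt := (x.1 + y.1, x.2 + y.2).
Definition qopp (x : elt) : elt := (- x.1, - x.2).
Definition qsub (x y : elt) : elt := (x.1 - y.1, x.2 - y.2).
Definition qmul (x y : elt) : elt :=
  (x.1 * y.1 + n * (x.2 * y.2), x.1 * y.2 + x.2 * y.1 + t * (x.2 * y.2)).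
Definition qscale (k : Z) (x : elt) : elt := (k * x.1, k * x.2).
Definition qconj (x : elt) : elt := (x.1 + t * x.2, - x.2).
Definition qtr (x : elt) : Z := 2 * x.1 + t * x.2.
Definition qnm (x : elt) : Z := x.1 * x.1 + t * (x.1 * x.2) - n * (x.2 * x.2).
Definition qeq (x y : elt) : bool := (x.1 =? y.1) && (x.2 =? y.2).
(** Two real conjugates are both nonnegative exactly when their sum and their product are. *)
Definition psd (x : elt) : bool := (0 <=? qtr x) && (0 <=? qnm x).
Definition tpos (x : elt) : bool := (0 <? qtr x) && (0 <? qnm x).
(** Keeps one element of each pair x, -x. Replacing v by -v makes B(v1, v) satisfy it. *)
Definition sgnpos (x : elt) : bool :=
  (0 <? x.2) || ((x.2 =? 0) && (0 <=? x.1)).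
(* As z mod 0 = z, an element of norm 0 divides only 0 here. *)
Definition qdvd (d x : elt) : bool :=
  let k := qnm d in let y := qmul x (qconj d) in
  (y.1 mod k =? 0) && (y.2 mod k =? 0).

Definition is_square (k : Z) : bool := let r := Z.sqrt k in r * r =? k.

Fixpoint zseq (lo : Z) (k : nat) : seq Z :=
  if k is k'.+1 then lo :: zseq (lo + 1) k' else [::].
Definition zrange (lo hi : Z) : seq Z := zseq lo (Z.to_nat (hi - lo + 1)).

(* All c such that T - c^2 is totally nonnegative. If c' is the conjugate of c, then (c + c')^2
   and (c - c')^2 are at most tr T + 2 sqrt(N T). *)
Definition bounded (T : elt) : seq elt :=
  let r2 := qtr T + 2 * (Z.sqrt (qnm T) + 1) in
  let r := Z.sqrt r2 in
  let s := Z.sqrt (r2 / (t * t + 4 * n)) in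
  flatten [seq [seq c <- [seq (x, y) | x <- zrange ((- r - t * y) / 2) ((r - t * y) / 2)]
                | psd (qsub T (qmul c c))]
          | y <- zrange (- s) s].

(* basal h may hold only if any v1, v2, v3 in L with h(v3) = h form a basis of L. *)
Variable basal : elt -> bool.

Section Plane.
Variables a2 b : elt.
Let m := qsub (qscale 4 a2) (qmul b b).

(* The possible (B(v1, v), B(v2, v), h(v)) for Q v = a, up to the sign of v, with the norm of
   h(v) and whether it is a square. *)
Definition options (a : elt) : seq (elt * elt * elt * Z * bool) :=
  let s2 := [seq (c, qmul c c) | c <- bounded (qscale 4 (qmul a2 a))] in
  let am := qmul a m in
  flatten [seq
    let bc := qmul b c1 in let base := qsub am (qmul a2 (qmul c1 c1)) in
    flatten [seq
      let h := qsub (qadd base (qmul bc c2.1)) c2.2 in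
      if psd h then let k := qnm h in [:: (c1, c2.1, h, k, is_square k)] else [::]
    | c2 <- s2]
  | c1 <- [seq c <- bounded (qscale 4 a) | sgnpos c]].

Section Base.
Variables (a3 p q h : elt) (nh : Z) (sq : bool).
Let e1 := qsub (qmul b q) (qscale 2 (qmul a2 p)).
Let e2 := qsub (qmul b p) (qscale 2 q).
Let h2 := qscale 2 h.

(* Here u = B(N, v) must satisfy u^2 = 4 h h'. The norms are compared first, because this
   rules out most options without enumerating B(v3, v); nh is the norm of h and sq tells
   whether nh is a square. *)
Definition omits (x : elt * seq (elt * elt * elt * Z * bool)) : bool :=
  match [seq v <- x.2 | if sq then v.2 else is_square (nh * v.1.2)] with
  | [::] => true
  | o =>
    let s := bounded (qscale 4 (qmul a3 x.1)) in
    all (fun v => let: (c1, c2, h', _, _) := v in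
      let l := qadd (qmul e1 c1) (qmul e2 c2) in
      let sqr := qscale 2 (qmul h2 h') in
      all (fun c3 => let u := qadd (qmul m c3) l in
        ~~ [&& qeq (qmul u u) sqr, basal h ==> qdvd h2 u & basal h' ==> qdvd u h2]) s) o
  end.
End Base.

(** Height 0 is rejected because N is useful only if v1, v2, v3 are independent. *)
Definition check_plane (a3 : elt) (targets : seq elt) : bool :=
  let ts := [seq (a, options a) | a <- targets] in
  [&& tpos a3, all tpos targets & all (fun v => let: (p, q, h, k, f) := v in
     ~~ qeq h (0, 0) && has (omits a3 p q h k f) ts) (options a3)].
End Plane.

(* Each plane (b, a3, targets) treats the case B(v1, v2) = b: whatever v3 with Q v3 = a3 is,
   one of the targets is missed. *)
Definition check (a2 : elt) (planes : seq (elt * elt * seq elt)) : bool :=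
  tpos a2 && all (fun b =>
     ~~ qeq (qsub (qscale 4 a2) (qmul b b)) (0, 0) &&
     has (fun x => qeq b x.1.1 && check_plane a2 b x.1.2 x.2) planes)
   [seq c <- bounded (qscale 4 a2) | sgnpos c].
End Checker.

Lemma sgnposN x : ~~ sgnpos x -> sgnpos (qopp x).
Proof. rewrite /sgnpos /=; lia. Qed.

Lemma mem_zrange (x lo hi : Z) : (lo <= x <= hi)%BZ -> x \in zrange lo hi.
Proof.
rewrite /zrange => hx; have : (x < lo + Z.of_nat (Z.to_nat (hi - lo + 1)))%BZ by lia.
have h1 : (lo <= x)%BZ by lia.
move: (Z.to_nat _) => k h2; elim: k lo {hx} h1 h2 => [|k IH] lo h1 h2 /=.
  by exfalso; lia.
rewrite inE; have [-> // | /eqP ne] := eqVneq x lo.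
by apply: IH; lia.
Qed.

Lemma is_square_mul (k : Z) : is_square (k * k).
Proof.
have -> : (k * k = Z.abs k * Z.abs k)%BZ by lia.
by rewrite /is_square Z.sqrt_square ?Z.eqb_refl //; lia.
Qed.

(** As 16 divides k^2, the residue of k mod 4 is 0. *)
Lemma is_square_16 (k x : Z) : (k * k = 16 * x)%BZ -> is_square x.
Proof.
move=> e; have -> : (x = (k / 4) * (k / 4))%BZ; last exact: is_square_mul.
have := Z.div_mod k 4; have := Z.mod_pos_bound k 4.
set r := (k mod 4)%BZ; set j := (k / 4)%BZ => h1 h2.
have [r0 | [r0 | [r0 | r0]]] : (r = 0 \/ r = 1 \/ r = 2 \/ r = 3)%BZ by lia.
all: by rewrite r0 in h2; nia.
Qed.

Lemma is_squareP x : is_square x -> exists k : Z, x = (k * k)%BZ.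
Proof. by move/Z.eqb_spec => e; exists (Z.sqrt x). Qed.

(** If r^2 divides s^2, then r divides s. This justifies the filter in [omits]: when h has square
    norm, h' must have square norm too. *)
Lemma is_square_cancel (r x : Z) :
  (r != 0)%BZ -> is_square (r * r * x) -> is_square x.
Proof.
move=> r0 /is_squareP[s e].
have dv : (Z.abs_nat r %| Z.abs_nat s)%N.
  rewrite -(@dvdn_pexp2r _ _ 2) //; apply/dvdnP; exists (Z.abs_nat x).
  by rewrite !expnS !expn0 !muln1; lia.
have /dvdnP[k ke] := dv.
have -> : (x = Z.of_nat k * Z.of_nat k)%BZ; last exact: is_square_mul.
have se : (s * s = (Z.of_nat k * Z.of_nat k) * (r * r))%BZ.
  have : (Z.abs s = Z.of_nat k * Z.abs r)%BZ by lia.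
  nia.
have : (r * r * (x - Z.of_nat k * Z.of_nat k) = 0)%BZ by nia.
move/eqP: r0 => r0; nia.
Qed.

Lemma rmorph_zR (R S : pzRingType) (f : {rmorphism R -> S}) z : f (zR R z) = zR S z.
Proof. exact: rmorph_int. Qed.

Definition qphi (F : pzRingType) (w : F) (x : elt) : F := zR F x.1 + zR F x.2 * w.

Section QuadraticRing.
Variables (t n : Z) (F : comPzRingType) (w : F).
Hypothesis w_sq : w ^+ 2 = zR F t * w + zR F n.
Local Notation phi := (qphi w).

Lemma qphiD x y : phi (qadd x y) = phi x + phi y.
Proof. rewrite /qphi /= !zRD; ring. Qed.

Lemma qphiN x : phi (qopp x) = - phi x.
Proof. rewrite /qphi /= !zRN; ring. Qed.

Lemma qphiB x y : phi (qsub x y) = phi x - phi y.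
Proof. rewrite /qphi /= !zRB; ring. Qed.

Lemma qphiM x y : phi (qmul t n x y) = phi x * phi y.
Proof. rewrite /qphi /= !(zRD, zRM); ring: w_sq. Qed.

Lemma qphiZ k x : phi (qscale k x) = zR F k * phi x.
Proof. rewrite /qphi /= !zRM; ring. Qed.

Lemma qphi_conj x : phi (qconj t x) = zR F (qtr t x) - phi x.
Proof. rewrite /qphi /qtr /= !(zRD, zRM, zRN) zR_2; ring. Qed.

Lemma qphi_nm x : phi x * phi (qconj t x) = zR F (qnm t n x).
Proof. rewrite /qphi /qnm /= !(zRD, zRM, zRN, zRB); ring: w_sq. Qed.

Lemma qphi_int z : phi (z, 0%BZ) = zR F z.
Proof. by rewrite /qphi /= mul0r addr0. Qed.
End QuadraticRing.

Lemma qmul1 t n x : qmul t n (1, 0)%BZ x = x.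
Proof. by case: x => x y; rewrite /qmul /=; congr pair; lia. Qed.

Lemma qnmM t n x y : qnm t n (qmul t n x y) = (qnm t n x * qnm t n y)%BZ.
Proof. rewrite /qnm /qmul /=; ring. Qed.

Lemma qnmZ t n k x : qnm t n (qscale k x) = (k * k * qnm t n x)%BZ.
Proof. rewrite /qnm /qscale /=; ring. Qed.

(** * Total positivity through trace and norm, and completeness of the enumeration *)

Section Positivity.
Variables (t n : Z).
Hypothesis disc_gt0 : (0 < t * t + 4 * n)%BZ.

(** The square of 2z - t is the discriminant, and a number of [algC] with nonnegative square is
    real. *)
Lemma quadratic_root_real (z : algC) :
  z ^+ 2 = zR algC t * z + zR algC n -> z \is Num.real.
Proof.
move=> zE; set r := z *+ 2 - zR algC t.
have rR : r \is Num.real.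
  rewrite realEsqr; have -> : r ^+ 2 = zR algC (t * t + 4 * n)%BZ.
    rewrite /r !(zRD, zRM) zR_4; ring: zE.
  by rewrite zR_ge0; lia.
have -> : z = (r + zR algC t) / 2 by rewrite /r; field.
by apply: rpred_div; [apply: rpredD => //; apply: zR_real | exact: rpred_nat].
Qed.

Variables (F : fieldType) (w : F).
Hypothesis w_sq : w ^+ 2 = zR F t * w + zR F n.
Local Notation phi := (qphi w).

Lemma rmorph_qphi (S : pzRingType) (s : {rmorphism F -> S}) x :
  s (phi x) = qphi (s w) x.
Proof. by rewrite rmorphD rmorphM !rmorph_zR. Qed.

Lemma rmorph_w_sq (s : {rmorphism F -> algC}) :
  s w ^+ 2 = zR algC t * s w + zR algC n.
Proof. by rewrite -rmorphXn w_sq rmorphD rmorphM !rmorph_zR. Qed.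

Lemma rmorph_qphi_real (s : {rmorphism F -> algC}) x : s (phi x) \is Num.real.
Proof.
rewrite rmorph_qphi; apply: rpredD; [|apply: rpredM]; try exact: zR_real.
exact: quadratic_root_real (rmorph_w_sq s).
Qed.

(** The images of x and of its conjugate are real, and their sum and product are positive. *)
Lemma tpos_sound (x : elt) (s : {rmorphism F -> algC}) : tpos t n x -> 0 < s (phi x).
Proof.
case/andP=> tr0 nm0.
have xR := rmorph_qphi_real s x; have yR := rmorph_qphi_real s (qconj t x).
have := qphi_nm (rmorph_w_sq s) x; rewrite -!rmorph_qphi.
have : s (phi x) + s (phi (qconj t x)) = zR _ (qtr t x).
  by rewrite (qphi_conj t w) rmorphB rmorph_zR addrC subrK.
move: (s (phi x)) (s (phi (qconj t x))) xR yR => u v uR vR uDv uMv.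
have := zR_gt0 algC (qnm t n x); rewrite nm0 -uMv => uv0.
have := zR_gt0 algC (qtr t x); rewrite tr0 -uDv => udv0.
case: (real_ltgtP (real0 _) uR) => // [u0 | u0]; last by move: uv0; rewrite -u0 mul0r ltxx.
have v0 : v < 0 by rewrite -(nmulr_rgt0 _ u0).
by have := ltrD u0 v0; rewrite addr0 => /lt_gtF; rewrite udv0.
Qed.

Variables s1 s2 : {rmorphism F -> algC}.
Hypothesis s12D : s1 w + s2 w = zR algC t.

(** As the images of w sum to t, the second embedding is the first one after conjugation. *)
Lemma s2_conj x : s2 (phi x) = s1 (phi (qconj t x)).
Proof.
rewrite !rmorph_qphi qphi_conj /qphi /qtr !(zRD, zRM) zR_2 -s12D; ring.
Qed.

Lemma psd_complete x : 0 <= s1 (phi x) -> 0 <= s2 (phi x) -> psd t n x.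
Proof.
move=> h1 h2; apply/andP; split.
  rewrite -(zR_ge0 algC) -[zR _ _](rmorph_zR s1) -[zR _ _](subrK (phi x)).
  by rewrite -(qphi_conj t w) rmorphD -s2_conj addr_ge0.
rewrite -(zR_ge0 algC) -[zR _ _](rmorph_zR s1) -(qphi_nm w_sq) rmorphM.
by rewrite -s2_conj mulr_ge0.
Qed.

Lemma psd_sound x (s : {rmorphism F -> algC}) : psd t n x -> 0 <= s (phi x).
Proof.
case/andP=> tr0 nm0.
have xR := rmorph_qphi_real s x; have yR := rmorph_qphi_real s (qconj t x).
have := qphi_nm (rmorph_w_sq s) x; rewrite -!rmorph_qphi.
have : s (phi x) + s (phi (qconj t x)) = zR _ (qtr t x).
  by rewrite (qphi_conj t w) rmorphB rmorph_zR addrC subrK.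
move: (s (phi x)) (s (phi (qconj t x))) xR yR => u v uR vR uDv uMv.
have := zR_ge0 algC (qnm t n x); rewrite nm0 -uMv => uv0.
have := zR_ge0 algC (qtr t x); rewrite tr0 -uDv => udv0.
case: (real_ltgtP (real0 _) uR) => // u0.
have v0 : v <= 0 by rewrite -(nmulr_rge0 _ u0).
by have := ltr_leD u0 v0; rewrite addr0 => /lt_geF; rewrite udv0.
Qed.

(** Let A, B and T1, T2 be the conjugates of c and T. From A^2 <= T1, B^2 <= T2 and T1 T2 <= s^2
    follows |AB| <= s, hence (A + B)^2 and (A - B)^2 are at most T1 + T2 + 2s. Here A + B is the
    trace of c, and (A - B)^2 is the discriminant times [c.2 ^ 2]. *)
Lemma bounded_norms (T c : elt) (s : Z) :
  psd t n (qsub T (qmul t n c c)) -> (0 <= s)%BZ -> (qnm t n T <= s * s)%BZ ->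
  (qtr t c * qtr t c <= qtr t T + 2 * s)%BZ /\
  ((t * t + 4 * n) * (c.2 * c.2) <= qtr t T + 2 * s)%BZ.
Proof.
move=> hp s0 hs.
have := psd_sound s2 hp; have := psd_sound s1 hp.
rewrite qphiB (qphiM w_sq) !rmorphB !rmorphM !subr_ge0 -!expr2.
have AR := rmorph_qphi_real s1 c; have BR := rmorph_qphi_real s2 c.
have ABD : s1 (phi c) + s2 (phi c) = zR _ (qtr t c).
  by rewrite s2_conj -rmorphD qphi_conj addrC subrK rmorph_zR.
have TD : s1 (phi T) + s2 (phi T) = zR _ (qtr t T).
  by rewrite s2_conj -rmorphD qphi_conj addrC subrK rmorph_zR.
have ABB : (s1 (phi c) - s2 (phi c)) ^+ 2 = zR _ ((t * t + 4 * n) * (c.2 * c.2))%BZ.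
  rewrite s2_conj -rmorphB -rmorphXn -(rmorph_zR s1); congr (s1 _).
  rewrite qphi_conj /qphi /qtr !(zRD, zRM) zR_2 zR_4; ring: w_sq.
have TM : s1 (phi T) * s2 (phi T) <= zR _ s ^+ 2.
  rewrite s2_conj -rmorphM (qphi_nm w_sq) rmorph_zR expr2 -zRM -subr_ge0 -zRB zR_ge0.
  by apply/Z.leb_spec0; lia.
move: (s1 (phi c)) (s2 (phi c)) (s1 (phi T)) (s2 (phi T)) AR BR ABD TD ABB TM.
move=> A B T1 T2 AR BR ABD TD ABB TM hA hB.
have A2 : 0 <= A ^+ 2 by rewrite -realEsqr.
have B2 : 0 <= B ^+ 2 by rewrite -realEsqr.
have sR : 0 <= zR algC s by rewrite zR_ge0; apply/Z.leb_spec0.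
have AB : `|A * B| <= zR algC s.
  rewrite -(@ler_pXn2r _ 2) ?nnegrE ?normr_ge0 // real_normK ?rpredM //.
  by rewrite exprMn (le_trans _ TM) // ler_pM.
have /andP[ABl ABu] : - zR algC s <= A * B <= zR algC s.
  by rewrite -real_ler_norml ?rpredM.
have conv (x y : Z) : zR algC x <= zR algC y -> (x <= y)%BZ.
  by rewrite -subr_ge0 -zRB zR_ge0 => /Z.leb_spec0; lia.
have rhs : zR algC (qtr t T + 2 * s)%BZ = T1 + T2 + 2 * zR algC s by rewrite zRD zRM zR_2 TD.
split; apply: conv; rewrite rhs.
  rewrite zRM -ABD (_ : _ * _ = A ^+ 2 + B ^+ 2 + 2 * (A * B)); last by ring.
  by rewrite !lerD // ler_pM2l ?ltr0n.
rewrite -ABB (_ : _ ^+ 2 = A ^+ 2 + B ^+ 2 + 2 * (- (A * B))); last by ring.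
by rewrite !lerD // ler_pM2l ?ltr0n // lerNl.
Qed.

Lemma bounded_complete (T c : elt) :
  psd t n (qsub T (qmul t n c c)) -> c \in bounded t n T.
Proof.
move=> hp; set s := (Z.sqrt (qnm t n T) + 1)%BZ.
have s0 : (0 <= s)%BZ by have := Z.sqrt_nonneg (qnm t n T); rewrite /s; lia.
have ns : (qnm t n T <= s * s)%BZ.
  case: (Z.le_gt_cases 0 (qnm t n T)) => h; last nia.
  by have := Z.sqrt_spec _ h; rewrite /s; lia.
have [h1 h2] := bounded_norms hp s0 ns.
rewrite /bounded -/s; set r2 := (_ + 2 * s)%BZ in h1 h2 *.
have sqrt_bound (x y : Z) : (x * x <= y)%BZ -> (- Z.sqrt y <= x <= Z.sqrt y)%BZ.
  move=> xy; have y0 : (0 <= y)%BZ by nia.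
  by have [? ?] := Z.sqrt_spec _ y0; have := Z.sqrt_nonneg y; nia.
have := sqrt_bound _ _ h1.
have : (c.2 * c.2 <= r2 / (t * t + 4 * n))%BZ by apply: Z.div_le_lower_bound; lia.
move=> /sqrt_bound h3 h4.
apply/flatten_mapP; exists c.2; first exact: mem_zrange.
rewrite mem_filter hp /=; apply/mapP; exists c.1; last by case: (c).
apply: mem_zrange; move: h4; rewrite /qtr; set r := Z.sqrt _.
have := Z.div_mod (- r - t * c.2) 2; have := Z.mod_pos_bound (- r - t * c.2) 2.
have := Z.div_mod (r - t * c.2) 2; have := Z.mod_pos_bound (r - t * c.2) 2.
lia.
Qed.
End Positivity.

(** * Universal ternary lattices and the finite search *)

Section Lattice.
Variables (t n : Z).
Hypothesis disc_gt0 : (0 < t * t + 4 * n)%BZ.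
Variables (F : fieldExtType rat) (w : F).
Hypothesis w_sq : w ^+ 2 = zR F t * w + zR F n.
Variables s1 s2 : {rmorphism F -> algC}.
Hypothesis s12D : s1 w + s2 w = zR algC t.
Local Notation phi := (qphi w).
Hypothesis phi_inj : injective phi.

Variables (V : vectType F) (Q : V -> F) (B : {biscalar V}) (L : set V).
Hypothesis QZ : forall a v, Q (a *: v) = a ^+ 2 * Q v.
Hypothesis QD : forall u v, Q (u + v) = Q u + Q v + B u v.
Hypothesis LD : forall u v, L u -> L v -> L (u + v).
Hypothesis LZ : forall x v, L v -> L (phi x *: v).
Hypothesis Qint : forall v, L v -> exists x, Q v = phi x.
Hypothesis Qpos : forall v, L v -> v != 0 -> forall s : {rmorphism F -> algC}, 0 < s (Q v).
Hypothesis Qrep : forall x, tpos t n x -> exists2 v, L v & Q v = phi x.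
Variable U : {vspace V}.
Hypothesis LU : forall v, L v -> v \in U.
Hypothesis dimU : \dim U = 3%N.

Let two_neq0 : (2 : F) != 0.
Proof. by rewrite -(fmorph_eq0 s1) rmorph_nat pnatr_eq0. Qed.

Lemma QN v : Q (- v) = Q v.
Proof. by rewrite -scaleN1r QZ sqrrN expr1n mul1r. Qed.

Lemma BC u v : B u v = B v u.
Proof. by apply: (addrI (Q u + Q v)); rewrite -QD addrC QD [Q v + _]addrC. Qed.

Lemma Bvv v : B v v = 2 * Q v.
Proof.
apply: (addrI (Q v + Q v)); rewrite -QD -[v + v]/(v *+ 2) -scaler_nat QZ; ring.
Qed.

Lemma BZl a u v : B (a *: u) v = a * B u v.
Proof. exact: linearZl_LR. Qed.

Lemma BZr a u v : B u (a *: v) = a * B u v.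
Proof. exact: linearZr_LR. Qed.

Lemma LN v : L v -> L (- v).
Proof.
by move=> Lv; have := LZ (-1, 0)%BZ Lv; rewrite qphi_int (_ : zR F (-1)%BZ = -1) ?scaleN1r.
Qed.

Lemma Bint u v : L u -> L v -> exists x, B u v = phi x.
Proof.
move=> Lu Lv; have [x Qu] := Qint Lu; have [y Qv] := Qint Lv.
have [z Quv] := Qint (LD Lu Lv); exists (qsub z (qadd x y)).
rewrite qphiB qphiD -Quv -Qu -Qv QD; ring.
Qed.

Lemma Q_ge0 v (s : {rmorphism F -> algC}) : L v -> 0 <= s (Q v).
Proof.
move=> Lv; have [-> | v0] := eqVneq v 0; last exact/ltW/Qpos.
by rewrite -[X in Q X](scale0r (0 : V)) QZ expr0n mul0r rmorph0.
Qed.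

(** Cauchy-Schwarz: the vector 2 Q(u) v - B(u, v) u lies in L, and its value is Q(u) times the
    expression. *)
Lemma gram2_ge0 u v (s : {rmorphism F -> algC}) : L u -> L v -> u != 0 ->
  0 <= s (4 * (Q u * Q v) - B u v ^+ 2).
Proof.
move=> Lu Lv u0; have [x Qu] := Qint Lu; have [y Buv] := Bint Lu Lv.
have LC : L (phi (qscale 2 x) *: v + phi (qopp y) *: u) by apply: LD; exact: LZ.
have := Q_ge0 s LC; rewrite qphiZ qphiN -Qu -Buv zR_2 QD !QZ BZl BZr [B v u]BC.
set z := (z in 0 <= s z -> _); have -> : z = Q u * (4 * (Q u * Q v) - B u v ^+ 2).
  by rewrite /z; ring.
by rewrite rmorphM pmulr_rge0 // Qpos.
Qed.

(** * The plane of v1 and v2 and its orthogonal line *)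

Section Frame.
Variables v1 v2 v3 : V.
Hypotheses (L1 : L v1) (L2 : L v2) (L3 : L v3) (Q1 : Q v1 = 1).
Let b := B v1 v2.
Let m := 4 * Q v2 - b ^+ 2.
Let e1 := b * B v2 v3 - 2 * (Q v2 * B v1 v3).
Let e2 := b * B v1 v3 - 2 * B v2 v3.
(* Half the Gram determinant of v1, v2, v, if Q v1 = 1. *)
Definition height v :=
  Q v * m + b * (B v1 v * B v2 v) - B v2 v ^+ 2 - Q v2 * B v1 v ^+ 2.
(* The pairing of v with the vector N := m v3 + e1 v1 + e2 v2, orthogonal to v1 and v2. *)
Definition normal v := m * B v3 v + (e1 * B v1 v + e2 * B v2 v).

Lemma v1_neq0 : v1 != 0.
Proof.
apply: contra_eq_neq Q1 => ->.
by rewrite -[X in Q X](scale0r (0 : V)) QZ expr0n mul0r eq_sym oner_neq0.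
Qed.

Hypothesis m0 : m != 0.

Lemma m_gt0 (s : {rmorphism F -> algC}) : 0 < s m.
Proof.
have := gram2_ge0 s L1 L2 v1_neq0; rewrite Q1 mul1r -/b -/m => m_ge0.
by rewrite lt_neqAle m_ge0 eq_sym fmorph_eq0 m0.
Qed.

(** The multiple by m of the component of v orthogonal to v1 and v2 lies in L and has value m h(v),
    where m is totally positive. *)
Lemma height_ge0 v (s : {rmorphism F -> algC}) : L v -> 0 <= s (height v).
Proof.
move=> Lv; have [a Q2] := Qint L2; have [x bE] := Bint L1 L2.
have [c C1] := Bint L1 Lv; have [d C2] := Bint L2 Lv.
pose M := qsub (qscale 4 a) (qmul t n x x).
pose E1 := qsub (qmul t n x d) (qscale 2 (qmul t n a c)).
pose E2 := qsub (qmul t n x c) (qscale 2 d).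
have LC : L (phi M *: v + phi E1 *: v1 + phi E2 *: v2).
  exact: LD (LD (LZ M Lv) (LZ E1 L1)) (LZ E2 L2).
have := Q_ge0 s LC.
rewrite /M /E1 /E2 !qphiB !qphiZ !(qphiM w_sq) zR_2 zR_4 -Q2 -bE -C1 -C2.
rewrite !(QD, QZ) !linearDl !linearZl_LR !linearZr_LR /= [B v v1]BC [B v v2]BC Q1 -/b.
set z := (z in 0 <= s z -> _); have -> : z = m * height v.
  by rewrite /z /height /m /=; ring.
by rewrite rmorphM pmulr_rge0 ?m_gt0.
Qed.

Hypothesis h0 : height v3 != 0.

Lemma frame_coord v : v \in U ->
  exists x1 x2 x3, v = x1 *: v1 + x2 *: v2 + x3 *: v3.
Proof.
have B11 : B v1 v1 = 2 by rewrite Bvv Q1 mulr1.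
have fr : free [tuple v1; v2; v3].
  apply/freeP => k; rewrite !big_ord_recl big_ord0 /= addr0.
  set k1 := k ord0; set k2 := k _; set k3 := k _ => k0.
  have E z : k1 * B z v1 + k2 * B z v2 + k3 * B z v3 = 0.
    have := congr1 (B z) k0; rewrite !linearDr !linearZr_LR /= linear0r => <-; ring.
  have E1 := E v1; have E2 := E v2; have E3 := E v3.
  rewrite B11 -/b in E1; rewrite Bvv [B v2 v1]BC -/b in E2.
  rewrite Bvv [B v3 v1]BC [B v3 v2]BC in E3.
  (* Pairing the relation with N = m v3 + e1 v1 + e2 v2 kills the terms in v1 and v2 and leaves 2 k3
     h(v3). *)
  have K3 : k3 = 0.
    apply: (mulIf (mulf_neq0 two_neq0 h0)).
    transitivity (e1 * (k1 * 2 + k2 * b + k3 * B v1 v3) +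
        e2 * (k1 * b + k2 * (2 * Q v2) + k3 * B v2 v3) +
        m * (k1 * B v1 v3 + k2 * B v2 v3 + k3 * (2 * Q v3))).
      rewrite /height /e1 /e2 /m; ring.
    by rewrite E1 E2 E3; ring.
  move: E1 E2; rewrite K3 !mul0r !addr0 => E1 E2.
  have K2 : k2 = 0.
    apply: (mulIf m0); transitivity (2 * (k1 * b + k2 * (2 * Q v2)) - b * (k1 * 2 + k2 * b)).
      by rewrite /m; ring.
    by rewrite E1 E2; ring.
  have K1 : k1 = 0.
    by apply: (mulIf two_neq0); rewrite mul0r -[RHS]E1 K2 mul0r addr0.
  move=> i; case: i => [[|[|[|i]]] Hi] //; [rewrite -K1|rewrite -K2|rewrite -K3];
    by congr (k _); apply: val_inj.
have sub : (<<[tuple v1; v2; v3]>> <= U)%VS.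
  by apply/span_subvP => x; rewrite !inE => /or3P[] /eqP ->; apply: LU.
have dm : \dim <<[tuple v1; v2; v3]>> = 3%N by move/eqP: fr.
have eqU : <<[tuple v1; v2; v3]>>%VS = U by apply/eqP; rewrite eqEdim sub dm dimU.
rewrite -eqU => /coord_span ->.
rewrite !big_ord_recl big_ord0 /= addr0 addrA.
by do 3!eexists.
Qed.

(** The form is split along the plane and the line of N, which are orthogonal, and denominators are
    cleared: Q(N) = m h(v3), and m is the determinant of the Gram matrix of the plane. *)
Lemma frame_form v v' : v \in U -> v' \in U ->
  m * (2 * height v3) * B v v' = normal v * normal v' + 2 * height v3 *
    (2 * (Q v2 * (B v1 v * B v1 v') + B v2 v * B v2 v') -
     b * (B v1 v * B v2 v' + B v2 v * B v1 v')).
Proof.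
move=> /frame_coord[x1 [x2 [x3 ->]]] /frame_coord[y1 [y2 [y3 ->]]].
rewrite /normal !(linearDl, linearDr) !(linearZl_LR, linearZr_LR) /=.
rewrite !Bvv [B v2 v1]BC [B v3 v1]BC [B v3 v2]BC Q1 -/b /height /e1 /e2 /m.
ring.
Qed.

(** On the diagonal of [frame_form], m Q(v) and the terms of the plane combine to h(v). *)
Lemma normal_sq v : v \in U -> normal v ^+ 2 = 4 * (height v3 * height v).
Proof.
move=> vU; have := frame_form vU vU; rewrite Bvv => E.
apply/eqP; rewrite expr2 -(subr_eq0 _ (_ * _)); apply/eqP.
transitivity (normal v * normal v + 2 * height v3 *
    (2 * (Q v2 * (B v1 v * B v1 v) + B v2 v * B v2 v) -
     b * (B v1 v * B v2 v + B v2 v * B v1 v)) - m * (2 * height v3) * (2 * Q v)).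
  by rewrite [height v]/height; ring.
by rewrite E subrr.
Qed.

Lemma normal_base : normal v3 = 2 * height v3.
Proof. rewrite /normal Bvv /height /e1 /e2 /m; ring. Qed.
End Frame.

Lemma rep_sgnpos v1 v : L v1 -> L v -> exists2 v', L v' & Q v' = Q v /\
  exists2 c, B v1 v' = phi c & sgnpos c.
Proof.
move=> L1 Lv; have [c Bc] := Bint L1 Lv.
have [cp | /sgnposN cn] := boolP (sgnpos c); first by exists v => //; split=> //; exists c.
exists (- v); first exact: LN.
by split; [rewrite QN | exists (qopp c); rewrite // linearNr Bc qphiN].
Qed.

Lemma psd_phi x : (forall s : {rmorphism F -> algC}, 0 <= s (phi x)) -> psd t n x.
Proof. by move=> h; apply: (psd_complete w_sq s12D). Qed.

Lemma bounded_gram u v a a' c : L u -> L v -> u != 0 ->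
  Q u = phi a -> Q v = phi a' -> B u v = phi c ->
  c \in bounded t n (qscale 4 (qmul t n a a')).
Proof.
move=> Lu Lv u0 Qu Qv Bc; apply: (bounded_complete disc_gt0 w_sq s12D).
apply: psd_phi => s; rewrite qphiB qphiZ !(qphiM w_sq) zR_4 -Qu -Qv -Bc -expr2.
exact: gram2_ge0.
Qed.

Lemma Q_neq0 v : Q v != 0 -> v != 0.
Proof.
by apply: contra_neq => ->; rewrite -[X in Q X](scale0r (0 : V)) QZ expr0n mul0r.
Qed.

(** * Soundness of the search *)

Section Plane.
Variables (a2 b : elt) (v1 v2 : V).
Hypotheses (L1 : L v1) (L2 : L v2) (Q1 : Q v1 = 1) (Q2 : Q v2 = phi a2).
Hypothesis (B12 : B v1 v2 = phi b).
Let m := qsub (qscale 4 a2) (qmul t n b b).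
Hypothesis m0 : m != (0, 0)%BZ.

Lemma phi_eq0 x : (phi x == 0) = (x == (0, 0)%BZ).
Proof.
have <- : phi (0, 0)%BZ = 0 by rewrite /qphi /= mul0r addr0.
exact: inj_eq.
Qed.

Lemma plane_discE : 4 * Q v2 - B v1 v2 ^+ 2 = phi m.
Proof. by rewrite qphiB qphiZ (qphiM w_sq) zR_4 -Q2 -B12 expr2. Qed.

Lemma plane_disc_neq0 : 4 * Q v2 - B v1 v2 ^+ 2 != 0.
Proof. by rewrite plane_discE phi_eq0. Qed.

Lemma v2_neq0 : v2 != 0.
Proof.
apply: contra_neq plane_disc_neq0 => ->; rewrite linear0r expr0n subr0.
by rewrite -[X in Q X](scale0r (0 : V)) QZ expr0n mul0r mulr0.
Qed.

(** The height in coordinates, with its operations in the order of [options] so that both unfold to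
    the same term. *)
Definition qheight (a c1 c2 : elt) :=
  qsub (qadd (qsub (qmul t n a m) (qmul t n a2 (qmul t n c1 c1)))
    (qmul t n (qmul t n b c1) c2)) (qmul t n c2 c2).

Lemma heightE v a c1 c2 : Q v = phi a -> B v1 v = phi c1 -> B v2 v = phi c2 ->
  height v1 v2 v = phi (qheight a c1 c2).
Proof.
move=> Qv Bv1 Bv2; rewrite /height plane_discE Qv Bv1 Bv2 B12 Q2 /qheight.
rewrite !(qphiB, qphiD, qphiM w_sq); ring.
Qed.

Lemma mem_options v a c1 c2 (h := qheight a c1 c2) : L v ->
  Q v = phi a -> B v1 v = phi c1 -> B v2 v = phi c2 -> sgnpos c1 ->
  (c1, c2, h, qnm t n h, is_square (qnm t n h)) \in options t n a2 b a.
Proof.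
move=> Lv Qv Bv1 Bv2 c1p; apply/flatten_mapP; exists c1.
  rewrite mem_filter c1p /= -[a](qmul1 t n).
  by apply: (bounded_gram L1 Lv (v1_neq0 Q1)); rewrite // Q1 qphi_int.
apply/flatten_mapP; exists (c2, qmul t n c2 c2).
  by apply: map_f; apply: (bounded_gram L2 Lv v2_neq0).
have hp : psd t n h.
  apply: psd_phi => s; rewrite -(heightE Qv Bv1 Bv2).
  exact: (height_ge0 L1 L2 Q1 plane_disc_neq0).
by rewrite /= -/m -/(qheight a c1 c2) -/h hp mem_seq1.
Qed.

Variable basal : elt -> bool.
Hypothesis basalP : forall u1 u2 u3 h, L u1 -> L u2 -> L u3 -> Q u1 = 1 ->
  height u1 u2 u3 = phi h -> basal h ->
  forall v, L v -> exists x1 x2 x3, v = phi x1 *: u1 + phi x2 *: u2 + phi x3 *: u3.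

(** N is orthogonal to v1 and v2. *)
Lemma normal_comb v3 v x1 x2 x3 : normal v1 v2 v3 (x1 *: v1 + x2 *: v2 + x3 *: v) =
  x3 * normal v1 v2 v3 v.
Proof.
rewrite /normal !linearDr !linearZr_LR /= !Bvv [B v2 v1]BC [B v3 v1]BC [B v3 v2]BC Q1.
ring.
Qed.

(** Multiplying by the conjugate of d turns z d into z N(d). If N(d) = 0, the product is 0, and 0
    mod 0 is 0. *)
Lemma qdvd_phi d x z : phi x = phi z * phi d -> qdvd t n d x.
Proof.
rewrite -(qphiM w_sq) => /phi_inj ->; rewrite /qdvd.
set y := qmul t n _ _; have [-> ->] : y.1 = (z.1 * qnm t n d)%BZ /\ y.2 = (z.2 * qnm t n d)%BZ.
  by rewrite /y /qmul /qnm /=; split; nia.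
move: (qnm t n d) => k; have [-> | k0] := Z.eq_dec k 0.
  by rewrite !Z.mul_0_r.
by rewrite !Z.mod_mul.
Qed.

Section Base.
Variables (a3 p q h : elt) (v3 : V).
Hypotheses (L3 : L v3) (Q3 : Q v3 = phi a3) (B13 : B v1 v3 = phi p).
Hypotheses (B23 : B v2 v3 = phi q) (H3 : height v1 v2 v3 = phi h).
Hypothesis h0 : h != (0, 0)%BZ.

Lemma base_height_neq0 : height v1 v2 v3 != 0.
Proof. by rewrite H3 phi_eq0. Qed.

Lemma v3_neq0 : v3 != 0.
Proof.
apply: contra_neq base_height_neq0 => ->; rewrite /height !linear0r.
by rewrite -[X in Q X](scale0r (0 : V)) QZ !expr0n !mul0r !mulr0 !subr0 addr0.
Qed.

Lemma qnm_neq0 x : x != (0, 0)%BZ -> (qnm t n x != 0)%BZ.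
Proof.
rewrite -phi_eq0 => x0; rewrite -(_ : (zR algC (qnm t n x) == 0) = (qnm t n x == 0)); last first.
  by rewrite zR_eq0; apply/idP/idP => /Z.eqb_spec/eqP.
rewrite -(rmorph_zR s1) -(qphi_nm w_sq) rmorphM -(s2_conj s12D).
by rewrite mulf_neq0 // fmorph_eq0.
Qed.

(** The pairings and the height of an actual vector v of value a pass every filter, so they refute
    [omits]. *)
Lemma omits_false v a c1 : L v -> Q v = phi a -> B v1 v = phi c1 -> sgnpos c1 ->
  omits t n basal a2 b a3 p q h (qnm t n h) (is_square (qnm t n h))
    (a, options t n a2 b a) = false.
Proof.
move=> Lv Qv Bv1 c1p; have [c2 Bv2] := Bint L2 Lv; have [c3 Bv3] := Bint L3 Lv.
have eo := mem_options Lv Qv Bv1 Bv2 c1p; have hE := heightE Qv Bv1 Bv2.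
move: eo hE; set h' := qheight _ _ _ => eo hE.
pose u := qadd (qmul t n m c3) (qadd
  (qmul t n (qsub (qmul t n b q) (qscale 2 (qmul t n a2 p))) c1)
  (qmul t n (qsub (qmul t n b p) (qscale 2 q)) c2)).
have uE : normal v1 v2 v3 v = phi u.
  rewrite /normal plane_discE Bv1 Bv2 Bv3 B12 B13 B23 Q2 /u.
  by rewrite !(qphiB, qphiD, qphiM w_sq, qphiZ) zR_2.
have usq : qmul t n u u = qscale 2 (qmul t n (qscale 2 h) h').
  apply: phi_inj; rewrite !(qphiZ, qphiM w_sq) zR_2 -uE -expr2.
  rewrite (normal_sq L1 L2 L3 Q1 plane_disc_neq0 base_height_neq0) ?LU // hE H3; ring.
(* Taking norms in u^2 = 4 h h' gives N(u)^2 = 16 N(h) N(h'). *)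
have nsq : is_square (qnm t n h * qnm t n h')%BZ.
  apply: (@is_square_16 (qnm t n u)); have := congr1 (qnm t n) usq.
  rewrite qnmM !(qnmZ, qnmM) => ->; ring.
have flt : if is_square (qnm t n h) then is_square (qnm t n h')
    else is_square (qnm t n h * qnm t n h')%BZ.
  case: ifP => // /is_squareP[r rE]; apply: (@is_square_cancel r).
    by apply: contra_neq (qnm_neq0 h0) => r0; rewrite rE r0.
  by rewrite -rE.
rewrite /omits [(_, _).2]/=; set o := [seq _ <- _ | _].
have : (c1, c2, h', qnm t n h', is_square (qnm t n h')) \in o by rewrite mem_filter flt.
case: o => // e o eio; apply/negP => /allP/(_ _ eio)/allP/(_ c3)/=.
have -> : c3 \in bounded t n (qscale 4 (qmul t n a3 a)).
  exact: (bounded_gram L3 Lv v3_neq0).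
move=> /(_ isT)/negP; apply; rewrite -/m -/u usq /qeq !Z.eqb_refl /=.
apply/andP; split; apply/implyP => bas.
  (* In the basis v1, v2, v3 the last coordinate x3 of v gives B(N, v) = x3 B(N, v3), and B(N, v3) =
     2 h. *)
  have [x1 [x2 [x3 vE]]] := basalP L1 L2 L3 Q1 H3 bas Lv.
  apply: (@qdvd_phi _ _ x3); rewrite -uE vE normal_comb qphiZ zR_2 -H3.
  by rewrite normal_base.
(* Now v1, v2, v is the basis, and expanding v3 in it gives 2 h = x3 B(N, v). *)
have [x1 [x2 [x3 vE]]] := basalP L1 L2 Lv Q1 hE bas L3.
apply: (@qdvd_phi _ _ x3); rewrite -uE -(normal_comb v3 v (phi x1) (phi x2)) -vE.
by rewrite normal_base qphiZ zR_2 H3.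
Qed.
End Base.

Lemma check_plane_sound a3 targets : check_plane t n basal a2 b a3 targets -> False.
Proof.
case/and3P=> t3 /allP tts /allP chk; have [u3 Lu Qu] := Qrep t3.
have [v3 L3 [Q3 [p B13 pp]]] := rep_sgnpos L1 Lu; rewrite {}Qu in Q3.
have [q B23] := Bint L2 L3; have := chk _ (mem_options L3 Q3 B13 B23 pp).
have := heightE Q3 B13 B23; set h := qheight _ _ _ => H3.
case/andP=> h0 /hasP[x /mapP[a ats ->]].
have [u Lu' Qu'] := Qrep (tts _ ats).
have [v Lv [Qv [c Bv cp]]] := rep_sgnpos L1 Lu'; rewrite {}Qu' in Qv.
have h0' : h != (0, 0)%BZ by apply: contra h0 => /eqP ->.
by rewrite (omits_false L3 Q3 B13 B23 H3 h0' Lv Qv Bv cp).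
Qed.
End Plane.

Lemma check_sound (basal : elt -> bool) a2 planes :
  (forall u1 u2 u3 h, L u1 -> L u2 -> L u3 -> Q u1 = 1 ->
    height u1 u2 u3 = phi h -> basal h ->
    forall v, L v -> exists x1 x2 x3, v = phi x1 *: u1 + phi x2 *: u2 + phi x3 *: u3) ->
  check t n basal a2 planes -> False.
Proof.
move=> basalP /andP[t2 /allP chk].
have [v1 L1 Q1] : exists2 v, L v & Q v = 1.
  have t1 : tpos t n (1, 0)%BZ.
    by rewrite /tpos /qtr /qnm /=; apply/andP; split; apply/Z.ltb_spec0; lia.
  by have [v Lv Qv] := Qrep t1; exists v; rewrite // Qv qphi_int.
have [u2 Lu Qu] := Qrep t2.
have [v2 L2 [Q2 [b B12 bp]]] := rep_sgnpos L1 Lu; rewrite {}Qu in Q2.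
have /chk : b \in [seq c <- bounded t n (qscale 4 a2) | sgnpos c].
  rewrite mem_filter bp /= -[a2](qmul1 t n).
  by apply: (bounded_gram L1 L2 (v1_neq0 Q1)); rewrite // Q1 qphi_int.
case/andP=> m0 /hasP[x _ /andP[_]].
have m0' : qsub (qscale 4 a2) (qmul t n b b) != (0, 0)%BZ by apply: contra m0 => /eqP ->.
exact: (check_plane_sound L1 L2 Q1 Q2 B12 m0' basalP).
Qed.

(** * Large discriminants *)

Lemma rational_pairing u v a a' c (s : Z) : L u -> L v -> u != 0 ->
  Q u = phi a -> Q v = phi a' -> B u v = phi c ->
  (0 <= s)%BZ -> (qnm t n (qscale 4 (qmul t n a a')) <= s * s)%BZ ->
  (qtr t (qscale 4 (qmul t n a a')) + 2 * s < t * t + 4 * n)%BZ ->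
  c.2 = 0%BZ /\ (4 * (c.1 * c.1) <= qtr t (qscale 4 (qmul t n a a')) + 2 * s)%BZ.
Proof.
move=> Lu Lv u0 Qu Qv Bc s0 ns lt.
have hp : psd t n (qsub (qscale 4 (qmul t n a a')) (qmul t n c c)).
  apply: psd_phi => f; rewrite qphiB qphiZ !(qphiM w_sq) zR_4 -Qu -Qv -Bc -expr2.
  exact: gram2_ge0.
have [h1 h2] := bounded_norms disc_gt0 w_sq s12D hp s0 ns.
(* The discriminant times [c.2 ^ 2] is smaller than the discriminant. *)
have c2 : c.2 = 0%BZ.
  have [//|c20] := Z.eq_dec c.2 0; have : (1 <= c.2 * c.2)%BZ by nia.
  by move=> h3; exfalso; nia.
by split=> //; move: h1; rewrite /qtr c2; lia.
Qed.

(* The three vectors have a rational Gram matrix and span the space, so a vector with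
   rational pairings against them has a rational value. *)
Lemma rational_frame_absurd (a2 a3 x b p q c1 c2 c3 : Z) v1 v2 v3 v :
  L v1 -> L v2 -> L v3 -> L v ->
  Q v1 = 1 -> Q v2 = phi (a2, 0)%BZ -> Q v3 = phi (a3, 0)%BZ -> Q v = phi (x, 1)%BZ ->
  B v1 v2 = phi (b, 0)%BZ -> B v1 v3 = phi (p, 0)%BZ -> B v2 v3 = phi (q, 0)%BZ ->
  B v1 v = phi (c1, 0)%BZ -> B v2 v = phi (c2, 0)%BZ -> B v3 v = phi (c3, 0)%BZ ->
  (4 * a2 - b * b <> 0)%BZ ->
  (a3 * (4 * a2 - b * b) + b * (p * q) - q * q - a2 * (p * p) <> 0)%BZ -> False.
Proof.
move=> L1 L2 L3 Lv Q1 Q2 Q3 Qv B12 B13 B23 Bv1 Bv2 Bv3 m0 h0.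
have ne (y : elt) : y.1 <> 0%BZ -> y != (0, 0)%BZ by move=> ny; apply/eqP => e; rewrite e in ny.
have m0' : qsub (qscale 4 (a2, 0)%BZ) (qmul t n (b, 0)%BZ (b, 0)%BZ) != (0, 0)%BZ.
  by apply: ne; rewrite /=; lia.
have hE := heightE Q2 B12 Q3 B13 B23; have hE' := heightE Q2 B12 Qv Bv1 Bv2.
have h0' : height v1 v2 v3 != 0.
  by rewrite hE phi_eq0; apply: ne; rewrite /qheight /qmul /=; lia.
have := normal_sq L1 L2 L3 Q1 (plane_disc_neq0 Q2 B12 m0') h0' (LU Lv).
have uE : normal v1 v2 v3 v = phi ((4 * a2 - b * b) * c3 +
   ((b * q - 2 * (a2 * p)) * c1 + (b * p - 2 * q) * c2), 0)%BZ.
  rewrite /normal Bv1 Bv2 Bv3 B12 B13 B23 Q2 !qphi_int !(zRD, zRB, zRM) zR_2 zR_4; ring.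
(* In B(N, v)^2 = 4 h(v3) h(v) the coefficient of w is 0 on the left. On the right it is 4 h(v3) (4
   a2 - b^2), because w enters h(v) only through Q(v). *)
rewrite uE hE hE' expr2 -zR_4 -!(qphiM w_sq) -(qphiZ w) => /phi_inj/(congr1 snd).
rewrite /qheight /qmul /qscale /qsub /qadd /=; nia.
Qed.

(** The value a is missed by x^2 + bxy + 2y^2 over the rationals: 3 for b = 1 and b = 2, but 5 for b
    = 0, since x^2 + 2y^2 takes the value 3 at (1, 1). The bounds leave finitely many triples to
    test. *)
Lemma ternary_form_nondegenerate (b p q : Z) :
  (0 <= b)%BZ -> (b * b <= 8)%BZ ->
  let a := if (b =? 0)%BZ then 5%BZ else 3%BZ in
  (p * p <= 4 * a)%BZ -> (q * q <= 8 * a)%BZ ->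
  (a * (4 * 2 - b * b) + b * (p * q) - q * q - 2 * (p * p) <> 0)%BZ.
Proof.
move=> b0 b8 a pa qa.
have chk : all (fun b => let a := if (b =? 0)%BZ then 5%BZ else 3%BZ in
    all (fun p => all (fun q =>
      ~~ (a * (4 * 2 - b * b) + b * (p * q) - q * q - 2 * (p * p) =? 0)%BZ)
      (zrange (-6) 6)) (zrange (-4) 4)) (zrange 0 2) by [].
have bi : b \in zrange 0 2 by apply: mem_zrange; nia.
have a5 : (a <= 5)%BZ by rewrite /a; case: ifP.
have pi : p \in zrange (-4) 4 by apply: mem_zrange; nia.
have qi : q \in zrange (-6) 6 by apply: mem_zrange; nia.
by move: chk => /allP/(_ b bi)/allP/(_ p pi)/allP/(_ q qi)/negP h /Z.eqb_spec.
Qed.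

(** The constants come from [rational_pairing]. Two rational values k, k' give the bound 16 k k',
    and k k' <= 10; a rational value k and x + w give 4 k tr + 8 k r, and k <= 5. *)
Lemma large_disc_absurd (x r : Z) : tpos t n (x, 1)%BZ -> (0 <= r)%BZ ->
  (qnm t n (x, 1)%BZ <= r * r)%BZ -> (160 < t * t + 4 * n)%BZ ->
  (20 * qtr t (x, 1)%BZ + 40 * r < t * t + 4 * n)%BZ -> False.
Proof.
move=> tx r0 nr D160 Dx.
have int_pos k : (0 < k)%BZ -> tpos t n (k, 0)%BZ.
  by move=> k0; rewrite /tpos /qtr /qnm /=; apply/andP; split; apply/Z.ltb_spec0; nia.
have ne0 u k : (0 < k)%BZ -> Q u = phi (k, 0)%BZ -> u != 0.
  move=> k0 Qu; apply: Q_neq0; rewrite Qu phi_eq0; apply/eqP => -[]; lia.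
have rat u u' k k' c : L u -> L u' -> (0 < k)%BZ -> (0 < k')%BZ -> (k * k' <= 10)%BZ ->
    Q u = phi (k, 0)%BZ -> Q u' = phi (k', 0)%BZ -> B u u' = phi c ->
    c = (c.1, 0)%BZ /\ (c.1 * c.1 <= 4 * (k * k'))%BZ.
  move=> Lu Lu' k0 k0' kk Qu Qu' Bc.
  have [] := @rational_pairing u u' _ _ c (4 * (k * k'))%BZ Lu Lu' (ne0 _ _ k0 Qu) Qu Qu' Bc.
  - nia.
  - by rewrite /qnm /qscale /qmul /=; nia.
  - by rewrite /qtr /qscale /qmul /=; nia.
  by rewrite /qtr /qscale /qmul /=; case: c {Bc} => c1 c2 /= -> h; split=> //; lia.
have [v1 L1 Q1] := Qrep (int_pos 1%BZ ltac:(lia)).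
have [u2 Lu2 Qu2] := Qrep (int_pos 2%BZ ltac:(lia)).
have [v2 L2 [Q2 [b B12 bp]]] := rep_sgnpos L1 Lu2; rewrite {}Qu2 in Q2.
have [bE b8] := rat _ _ 1%BZ 2%BZ _ L1 L2 ltac:(lia) ltac:(lia) ltac:(lia) Q1 Q2 B12.
have b0 : (0 <= b.1)%BZ by move: bp; rewrite bE /sgnpos /=; lia.
pose a := if (b.1 =? 0)%BZ then 5%BZ else 3%BZ.
have a0 : (0 < a)%BZ by rewrite /a; case: ifP.
have a5 : (a <= 5)%BZ by rewrite /a; case: ifP.
have [v3 L3 Q3] := Qrep (int_pos a a0).
have [p B13] := Bint L1 L3; have [q B23] := Bint L2 L3.
have [pE pa] := rat _ _ 1%BZ a _ L1 L3 ltac:(lia) a0 ltac:(lia) Q1 Q3 B13.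
have [qE qa] := rat _ _ 2%BZ a _ L2 L3 ltac:(lia) a0 ltac:(lia) Q2 Q3 B23.
have [v Lv Qv] := Qrep tx.
have ratv u k c : L u -> (0 < k)%BZ -> (k <= 5)%BZ -> Q u = phi (k, 0)%BZ ->
    B u v = phi c -> c = (c.1, 0)%BZ.
  move=> Lu k0 k5 Qu Bc.
  have [] := @rational_pairing u v _ _ c (4 * (k * r))%BZ Lu Lv (ne0 _ _ k0 Qu) Qu Qv Bc.
  - nia.
  - move: nr; rewrite qnmZ qnmM; set N := qnm t n (x, _) => nr.
    by rewrite (_ : qnm t n (k, 0)%BZ = k * k)%BZ; [nia | rewrite /qnm /=; lia].
  - move: Dx tx => Dx /andP[/Z.ltb_spec0 tr0 _].
    rewrite (_ : qtr _ _ = 4 * (k * qtr t (x, 1)))%BZ; first nia.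
    by rewrite /qtr /qscale /qmul /=; lia.
  by case: c {Bc} => c1 c2 /= -> _.
have [c1 Bv1] := Bint L1 Lv; have [c2 Bv2] := Bint L2 Lv; have [c3 Bv3] := Bint L3 Lv.
rewrite bE in B12; rewrite pE in B13; rewrite qE in B23.
have cE1 := ratv _ 1%BZ _ L1 ltac:(lia) ltac:(lia) Q1 Bv1; rewrite cE1 in Bv1.
have cE2 := ratv _ 2%BZ _ L2 ltac:(lia) ltac:(lia) Q2 Bv2; rewrite cE2 in Bv2.
have cE3 := ratv _ _ _ L3 a0 a5 Q3 Bv3; rewrite cE3 in Bv3.
rewrite qphi_int in Q1.
apply: (rational_frame_absurd L1 L2 L3 Lv Q1 Q2 Q3 Qv B12 B13 B23 Bv1 Bv2 Bv3).
  have b2 : (b.1 <= 2)%BZ by nia.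
  nia.
have b8' : (b.1 * b.1 <= 8)%BZ by lia.
have pa' : (p.1 * p.1 <= 4 * a)%BZ by lia.
have qa' : (q.1 * q.1 <= 8 * a)%BZ by lia.
exact: (ternary_form_nondegenerate b0 b8' pa' qa').
Qed.

(** * Free lattices *)

Section Free.
Variables e1 e2 e3 : V.
Hypotheses (Le1 : L e1) (Le2 : L e2) (Le3 : L e3).
Let comb a b c := a *: e1 + b *: e2 + c *: e3.
Hypothesis L_comb : forall v, L v -> exists a b c, v = comb (phi a) (phi b) (phi c).
Hypothesis nm_mod5 : forall c, let k := (qnm t n c mod 5)%BZ in (k = 0 \/ k = 1 \/ k = 4)%BZ.

Let combD a b c a' b' c' : comb a b c + comb a' b' c' = comb (a + a') (b + b') (c + c').
Proof. by rewrite /comb !scalerDl addrACA [X in X + _ = _]addrACA. Qed.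

Let combZ x a b c : x *: comb a b c = comb (x * a) (x * b) (x * c).
Proof. by rewrite /comb !scalerDr !scalerA. Qed.

Let B_comb a b c a' b' c' : B (comb a b c) (comb a' b' c') =
  a * a' * (2 * Q e1) + b * b' * (2 * Q e2) + c * c' * (2 * Q e3) +
  (a * b' + b * a') * B e1 e2 + (a * c' + c * a') * B e1 e3 + (b * c' + c * b') * B e2 e3.
Proof.
rewrite /comb !(linearDl, linearDr) !(linearZl_LR, linearZr_LR) /= !Bvv.
rewrite [B e2 e1]BC [B e3 e1]BC [B e3 e2]BC; ring.
Qed.

Let Q_comb a b c : Q (comb a b c) = a ^+ 2 * Q e1 + b ^+ 2 * Q e2 + c ^+ 2 * Q e3 +
  a * b * B e1 e2 + a * c * B e1 e3 + b * c * B e2 e3.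
Proof. by apply: (mulfI two_neq0); rewrite -Bvv B_comb; ring. Qed.

(** Half the Gram determinant of three vectors; it agrees with [height] if Q(u1) = 1. *)
Definition half_disc u1 u2 u3 := 4 * (Q u1 * Q u2 * Q u3) + B u1 u2 * B u1 u3 * B u2 u3 -
  Q u1 * B u2 u3 ^+ 2 - Q u2 * B u1 u3 ^+ 2 - Q u3 * B u1 u2 ^+ 2.

(** A linear substitution multiplies a Gram determinant by the square of its determinant. *)
Lemma half_disc_comb a b c a' b' c' a'' b'' c'' :
  half_disc (comb a b c) (comb a' b' c') (comb a'' b'' c'') =
  (a * (b' * c'' - c' * b'') - b * (a' * c'' - c' * a'') + c * (a' * b'' - b' * a'')) ^+ 2 *
  half_disc e1 e2 e3.
Proof. by rewrite /half_disc !Q_comb !B_comb; ring. Qed.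

(* If N(h) = N(d)^2 N(h0), then N(d)^2 divides N(h), and N(d) is 0, 1 or -1 mod 5. *)
Definition basal_mod5 (h : elt) : bool :=
  let k := Z.abs (qnm t n h) in
  (0 <? k)%BZ && all (fun j => ~~ (k mod (j * j) =? 0)%BZ || ((j mod 5 =? 2) || (j mod 5 =? 3))%BZ)
    (zrange 2 (Z.sqrt k)).

(** The test leaves only |N(d)| = 1, and then the conjugate of d is its inverse up to sign. *)
Lemma basal_mod5_unit d h : basal_mod5 (qmul t n (qmul t n d d) h) ->
  exists z, phi z * phi d = 1.
Proof.
case/andP; rewrite !qnmM !Z.abs_mul; set j := Z.abs (qnm t n d); set k := Z.abs _.
move=> /Z.ltb_spec0 k0 /allP chk.
have jE := nm_mod5 d; have j0 : (0 <= j)%BZ by rewrite /j; lia.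
have k1 : (1 <= k)%BZ.
  have : (0 <= k)%BZ by rewrite /k; lia.
  nia.
have [j1 | j2] : (j = 1 \/ 2 <= j)%BZ by nia.
  have [e | e] : (qnm t n d = 1 \/ qnm t n d = -1)%BZ by rewrite /j in j1; lia.
    by exists (qconj t d); rewrite mulrC (qphi_nm w_sq) e.
  by exists (qopp (qconj t d)); rewrite qphiN mulrC mulrN (qphi_nm w_sq) e opprK.
have /chk : j \in zrange 2 (Z.sqrt (j * j * k)).
  have jj : (0 <= j * j)%BZ by nia.
  by apply: mem_zrange; split=> //; apply/Z.sqrt_le_square => //; nia.
have -> : (j * j * k mod (j * j) =? 0)%BZ.
  by rewrite Z.mul_comm Z.mod_mul //; nia.
have := Z.div_mod j 5; have := Z.mod_pos_bound j 5.
have := Z.div_mod (qnm t n d) 5; move: jE; rewrite /j /=; lia.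
Qed.

Lemma free_basal u1 u2 u3 h : L u1 -> L u2 -> L u3 -> Q u1 = 1 ->
  height u1 u2 u3 = phi h -> basal_mod5 h ->
  forall v, L v -> exists x1 x2 x3, v = phi x1 *: u1 + phi x2 *: u2 + phi x3 *: u3.
Proof.
move=> L1 L2 L3 Q1 hE hb v Lv.
have hdE : half_disc u1 u2 u3 = phi h.
  by rewrite -hE /half_disc /height Q1; ring.
have [a1 [b1 [c1 E1]]] := L_comb L1; have [a2 [b2 [c2 E2]]] := L_comb L2.
have [a3 [b3 [c3 E3]]] := L_comb L3; have [a [b [c Ev]]] := L_comb Lv.
have [h0 h0E] : exists h0, half_disc e1 e2 e3 = phi h0.
  have [q1 Qe1] := Qint Le1; have [q2 Qe2] := Qint Le2; have [q3 Qe3] := Qint Le3.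
  have [r1 B1] := Bint Le2 Le3; have [r2 B2] := Bint Le1 Le3; have [r3 B3] := Bint Le1 Le2.
  pose M x y := qmul t n x y.
  exists (qsub (qsub (qsub (qadd (qscale 4 (M (M q1 q2) q3)) (M (M r3 r2) r1))
    (M q1 (M r1 r1))) (M q2 (M r2 r2))) (M q3 (M r3 r3))).
  by rewrite /half_disc Qe1 Qe2 Qe3 B1 B2 B3 /M !(qphiD, qphiB, qphiZ, qphiM w_sq) zR_4; ring.
pose M x y := qmul t n x y.
(* The determinant of the coordinates of u1, u2, u3 with respect to e1, e2, e3. *)
pose d := qadd (qsub (M a1 (qsub (M b2 c3) (M c2 b3))) (M b1 (qsub (M a2 c3) (M c2 a3))))
  (M c1 (qsub (M a2 b3) (M b2 a3))).
have dE : phi d = phi a1 * (phi b2 * phi c3 - phi c2 * phi b3) -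
   phi b1 * (phi a2 * phi c3 - phi c2 * phi a3) + phi c1 * (phi a2 * phi b3 - phi b2 * phi a3).
  by rewrite /d /M !(qphiD, qphiB, qphiM w_sq).
have hd : h = M (M d d) h0.
  apply: phi_inj; rewrite -hdE E1 E2 E3 half_disc_comb -dE h0E /M !(qphiM w_sq) expr2 //.
have [z zd] : exists z, phi z * phi d = 1.
  by apply: (@basal_mod5_unit d h0); have := hb; rewrite hd.
(* Cramer's rule: z inverts d, and the coordinates of v replace those of u1, u2, u3 in turn. *)
pose x1 := M z (qadd (qsub (M a (qsub (M b2 c3) (M c2 b3))) (M b (qsub (M a2 c3) (M c2 a3))))
  (M c (qsub (M a2 b3) (M b2 a3)))).
pose x2 := M z (qadd (qsub (M a1 (qsub (M b c3) (M c b3))) (M b1 (qsub (M a c3) (M c a3))))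
  (M c1 (qsub (M a b3) (M b a3)))).
pose x3 := M z (qadd (qsub (M a1 (qsub (M b2 c) (M c2 b))) (M b1 (qsub (M a2 c) (M c2 a))))
  (M c1 (qsub (M a2 b) (M b2 a)))).
exists x1, x2, x3; rewrite Ev E1 E2 E3 !combZ !combD.
rewrite /x1 /x2 /x3 /M !(qphiD, qphiB, qphiM w_sq).
by congr comb; rewrite -[LHS]mul1r -zd dE; ring.
Qed.
End Free.
End Lattice.

(** * The field and its two embeddings *)

(** The squared denominator of q is coprime to the squared numerator, hence divides D. *)
Lemma squarefree_rat_int (D : nat) (q : rat) : (1 < D)%N -> squarefree D ->
  D%:R * q ^+ 2 \is a Num.int -> q \is a Num.int.
Proof.
move=> D1 sqf /intrP[k kE].
have dq0 : (denq q)%:~R != 0 :> rat by rewrite intr_eq0 denq_neq0.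
have e : D%:Z * (numq q * numq q) = k * (denq q * denq q).
  apply: (@intr_inj rat); rewrite !intrM -kE -[q in q ^+ 2]divq_num_den.
  by rewrite -pmulrn; field.
have dv : (`|denq q| ^ 2 %| D)%N.
  rewrite -(@Gauss_dvdl _ _ (`|numq q| ^ 2)); last first.
    by rewrite coprimeXl // coprimeXr // coprime_sym coprime_num_den.
  apply/dvdnP; exists `|k|%N; have := congr1 absz e.
  by rewrite !abszM !mulnn.
have := sqf _ dv => d1; rewrite Qint_def.
by rewrite -absz_denq d1.
Qed.

(** If q^2 = D, then D (q / D)^2 = 1, so q / D is an integer j with D j^2 = 1. *)
Lemma squarefree_nonsquare (D : nat) (q : rat) :
  (1 < D)%N -> squarefree D -> q ^+ 2 != D%:R.
Proof.
move=> D1 sqf; apply/eqP => qD; have D0 : D%:R != 0 :> rat by rewrite pnatr_eq0; lia.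
have /intrP[j jE] : q / D%:R \is a Num.int.
  apply: (squarefree_rat_int D1 sqf).
  by rewrite exprMn qD exprVn expr2 invfM mulrA mulrACA divff // mulr1 divff.
have qE : q = D%:R * j%:~R by rewrite -jE mulrC divfK.
move: qD; rewrite qE exprMn expr2 -mulrA => /(congr1 (fun z => z / D%:R)).
rewrite mulrC mulKf // divff // -rmorphXn pmulrn -rmorphM /= => /eqP.
rewrite -[1]/(1%:~R) eqr_int => /eqP e.
have := congr1 absz e; rewrite abszM abszX absz_nat => /eqP.
by rewrite muln_eq1 => /andP[/eqP d1 _]; rewrite d1 in D1.
Qed.

Section QuadraticField.
Variables (D : nat) (F : fieldExtType rat) (x : F).
Hypotheses (D_gt1 : (1 < D)%N) (D_sqfree : squarefree D) (x_sq : x ^+ 2 = D%:R).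
Hypothesis F_gen : <<1; x>>%VS = fullv.

Let ia (a : rat) : F := a%:A.
Let iaD a b : ia (a + b) = ia a + ia b. Proof. exact: scalerDl. Qed.

Let iaM a b : ia (a * b) = ia a * ia b.
Proof. by rewrite /ia -scalerA -scalerAl mul1r. Qed.

Let iaN a : ia (- a) = - ia a. Proof. exact: scaleNr. Qed.

Let ia_nat n : ia n%:R = n%:R. Proof. exact: (rmorph_nat (in_alg F)). Qed.

Let ia_inj : injective ia. Proof. exact: (fmorph_inj (in_alg F)). Qed.

Let ia0 : ia 0 = 0. Proof. exact: scale0r. Qed.

Lemma quad_coord z : exists a b : rat, z = ia a + ia b * x.
Proof.
have /Fadjoin_polyP[p /polyOverP pov ->] : z \in <<1; x>>%VS by rewrite F_gen memvf.
have pow i : exists a b : rat, x ^+ i = ia a + ia b * x.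
  elim: i => [|i [a [b IH]]]; first by exists 1, 0; rewrite ia0 mul0r addr0 /ia scale1r.
  exists (b * D%:R), a; rewrite exprSr IH iaM ia_nat -x_sq; ring.
rewrite horner_coef; elim/big_rec: _ => [|i y _ [a [b ->]]].
  by exists 0, 0; rewrite ia0 mul0r addr0.
have /vlineP[c cE] := pov i; have [a' [b' ->]] := pow i.
exists (c * a' + a), (c * b' + b); rewrite cE !iaD !iaM -/(ia c); ring.
Qed.

Lemma quad_coord_inj a b a' b' :
  ia a + ia b * x = ia a' + ia b' * x -> a = a' /\ b = b'.
Proof.
move=> e; have e' : ia (a - a') = ia (b' - b) * x.
  rewrite !(iaD, iaN); move/eqP: e; rewrite -subr_eq0 => /eqP e.
  by apply/eqP; rewrite -subr_eq0; apply/eqP; rewrite -[RHS]e; ring.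
have [bb | bb] := eqVneq (b' - b) 0.
  move/eqP: bb; rewrite subr_eq0 => /eqP bb; split=> //.
  by move: e' => /eqP; rewrite bb subrr ia0 mul0r -ia0 (inj_eq ia_inj) subr_eq0 => /eqP.
have /eqP[] := squarefree_nonsquare ((a - a') / (b' - b)) D_gt1 D_sqfree.
apply: ia_inj; rewrite ia_nat -x_sq expr2 iaM; set c := _ / _.
have cx : ia c = x.
  apply: (@mulfI _ (ia (b' - b))); first by rewrite -ia0 (inj_eq ia_inj).
  by rewrite -e' -iaM /c mulrC divfK.
by rewrite cx expr2.
Qed.

Section Embedding.
Variable e : algC.
Hypothesis e_sq : e ^+ 2 = D%:R.

Lemma quad_coord_pair z : exists p : rat * rat, z == ia p.1 + ia p.2 * x.
Proof. by have [a [b ->]] := quad_coord z; exists (a, b). Qed.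

(** The embedding that sends x to e. Coordinates are unique, so the choice has only one outcome. *)
Definition quad_emb (z : F) : algC :=
  let p := xchoose (quad_coord_pair z) in ratr p.1 + ratr p.2 * e.

Lemma quad_embE a b : quad_emb (ia a + ia b * x) = ratr a + ratr b * e.
Proof.
rewrite /quad_emb; set P := quad_coord_pair _.
have /eqP := xchooseP P; move: (xchoose P) => p /= {P} /quad_coord_inj[-> ->] //.
Qed.

Lemma quad_emb_additive : zmod_morphism quad_emb.
Proof.
move=> u v; have [a [b ->]] := quad_coord u; have [a' [b' ->]] := quad_coord v.
rewrite (_ : _ - _ = ia (a - a') + ia (b - b') * x); last by rewrite !(iaD, iaN); ring.
by rewrite !quad_embE !rmorphB; ring.
Qed.

Lemma quad_emb_multiplicative : monoid_morphism quad_emb.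
Proof.
split.
  rewrite (_ : 1 = ia 1 + ia 0 * x) ?quad_embE ?rmorph1 ?rmorph0 ?mul0r ?addr0 //.
  by rewrite ia0 mul0r addr0 /ia scale1r.
move=> u v; have [a [b ->]] := quad_coord u; have [a' [b' ->]] := quad_coord v.
rewrite (_ : _ * _ = ia (a * a' + b * b' * D%:R) + ia (a * b' + b * a') * x); last first.
  by rewrite !(iaD, iaM) ia_nat -x_sq; ring.
by rewrite !quad_embE !(rmorphD, rmorphM) rmorph_nat -e_sq; ring.
Qed.

HB.instance Definition _ := GRing.isZmodMorphism.Build F algC quad_emb quad_emb_additive.
HB.instance Definition _ := GRing.isMonoidMorphism.Build F algC quad_emb quad_emb_multiplicative.

Lemma quad_embedding : exists s : {rmorphism F -> algC}, s x = e.
Proof.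
exists quad_emb; rewrite -[in LHS](add0r x) -[in LHS](mul1r x).
have <- : ia 0 = 0 by exact: ia0.
have <- : ia 1 = 1 by rewrite /ia scale1r.
by rewrite /= quad_embE rmorph0 rmorph1 add0r mul1r.
Qed.
End Embedding.

Lemma quad_conjugates : exists s1 s2 : {rmorphism F -> algC}, s1 x + s2 x = 0.
Proof.
have sqD : sqrtC (D%:R : algC) ^+ 2 = D%:R by rewrite sqrtCK.
have [s1 e1] := quad_embedding sqD.
have [s2 e2] := quad_embedding (etrans (sqrrN _) sqD).
by exists s1, s2; rewrite e1 e2 subrr.
Qed.

Lemma integral_Aint (s : {rmorphism F -> algC}) z : ring_of_integers z -> s z \in Aint.
Proof.
move=> /(integral_rmorph s)[p pm pz]; apply: (root_monic_Aint pz).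
  exact: monic_map.
by apply/polyOverP => i; rewrite coef_map /= rmorph_int intr_int.
Qed.

(** Sum and product of the two conjugates are algebraic integers and rational. *)
Lemma integral_trace_norm a b : ring_of_integers (ia a + ia b * x) ->
  2 * a \is a Num.int /\ a ^+ 2 - D%:R * b ^+ 2 \is a Num.int.
Proof.
have [s1 [s2 e]] := quad_conjugates; move=> zi.
have h1 := integral_Aint s1 zi; have h2 := integral_Aint s2 zi.
have ra (s : {rmorphism F -> algC}) c : s (ia c) = ratr c.
  by rewrite -(fmorph_eq_rat (s \o in_alg F)).
move: h1 h2; rewrite !rmorphD !rmorphM !ra.
have -> : s2 x = - s1 x by apply/eqP; rewrite -addr_eq0 addrC e.
have sx : s1 x * s1 x = D%:R by rewrite -rmorphM -expr2 x_sq rmorph_nat.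
move=> h1 h2; split; rewrite -Cint_rat; apply: Cint_rat_Aint; rewrite ?Crat_rat //.
  have := rpredD h1 h2; rewrite (_ : _ + _ = ratr (2 * a)) //.
  by rewrite rmorphM rmorph_nat; ring.
have := rpredM h1 h2; rewrite (_ : _ * _ = ratr (a ^+ 2 - D%:R * b ^+ 2)) //.
rewrite rmorphB !expr2 !rmorphM rmorph_nat /= -sx; ring.
Qed.

(** * The ring of integers *)

Definition quad_t : Z := if (D %% 4 == 1)%N then 1%BZ else 0%BZ.
(** For D = 1 mod 4, w = (1 + x) / 2 satisfies w^2 = w + (D - 1) / 4, and the quotient of D by 4
    rounds down to (D - 1) / 4. *)
Definition quad_n : Z := if (D %% 4 == 1)%N then Z.of_nat (D %/ 4) else Z.of_nat D.
Definition quad_w : F := if (D %% 4 == 1)%N then (1 + x) / 2 else x.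

Lemma two_neq0 : (2 : F) != 0.
Proof. by rewrite -ia_nat -ia0 (inj_eq ia_inj). Qed.

Lemma quad_w_sq : quad_w ^+ 2 = zR F quad_t * quad_w + zR F quad_n.
Proof.
rewrite /quad_w /quad_t /quad_n; case: ifP => [/eqP d1 | _]; last first.
  by rewrite x_sq zR_nat (_ : zR F 0%BZ = 0) // mul0r add0r.
have DE : D%:R = 4 * (D %/ 4)%:R + 1 :> F.
  by rewrite -natrM natr1; congr (_%:R); rewrite {1}(divn_eq D 4) d1; lia.
have x2 : x * x = 4 * (D %/ 4)%:R + 1 by rewrite -DE -x_sq.
rewrite zR_nat (_ : zR F 1%BZ = 1) // mul1r.
have t0 := two_neq0; have t4 : (4 : F) = 2 * 2 by ring.
rewrite expr2 mulf_div.
rewrite (_ : (1 + x) * (1 + x) = 2 * (1 + x) + 2 * 2 * (D %/ 4)%:R); last by ring: x2.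
by field; rewrite t4 mulf_neq0 t0.
Qed.

Lemma quad_disc_gt0 : (0 < quad_t * quad_t + 4 * quad_n)%BZ.
Proof. rewrite /quad_t /quad_n; case: ifP; lia. Qed.

Lemma quad_w_conj : exists s1 s2 : {rmorphism F -> algC},
  s1 quad_w + s2 quad_w = zR algC quad_t.
Proof.
have [s1 [s2 e]] := quad_conjugates; exists s1, s2; rewrite /quad_w /quad_t.
case: ifP => _; last by rewrite e.
rewrite !fmorph_div !rmorph_nat !rmorphD !rmorph1 -mulrDl.
rewrite (_ : 1 + s1 x + _ = 2 + (s1 x + s2 x)); last by ring.
by rewrite e addr0 divff ?pnatr_eq0.
Qed.

Lemma zR_ia k : zR F k = ia (zR rat k).
Proof. by rewrite /ia -(rmorph_zR (in_alg F)). Qed.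

Lemma quad_phi y : qphi quad_w y =
  if (D %% 4 == 1)%N then ia (zR rat y.1 + zR rat y.2 / 2) + ia (zR rat y.2 / 2) * x
  else ia (zR rat y.1) + ia (zR rat y.2) * x.
Proof.
rewrite /qphi /quad_w !zR_ia; case: ifP => // _.
have i2 : (2 : F)^-1 = ia 2^-1.
  apply: (mulfI two_neq0); rewrite mulfV ?two_neq0 // -(ia_nat 2) -iaM mulfV //.
  by rewrite /ia scale1r.
by rewrite i2 iaD iaM; ring.
Qed.

Lemma quad_phi_inj : injective (qphi quad_w).
Proof.
move=> [a b] [c d]; rewrite !quad_phi /=; case: ifP => _ /quad_coord_inj[].
  move=> e1 e2; have bd : zR rat b = zR rat d.
    by apply: (mulIf (_ : 2^-1 != 0)) => //; rewrite invr_eq0 pnatr_eq0.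
  move: e1; rewrite bd => /addIr/zR_inj ->.
  by rewrite (zR_inj bd).
by move=> /zR_inj -> /zR_inj ->.
Qed.

(** Let T = 2a and S = 2b. D S^2 is an integer, hence so is S as D is squarefree. Modulo 4, T^2 - D
    S^2 = 4 N forces T and S to have equal parity if D = 1 mod 4, and to be even if D = 2 or 3 mod
    4. *)
Lemma quad_integer_phi z : ring_of_integers z -> exists y, z = qphi quad_w y.
Proof.
have [a [b ->]] := quad_coord z; move=> /integral_trace_norm[aT abN].
have bS : 2 * b \is a Num.int.
  apply: (squarefree_rat_int D_gt1 D_sqfree).
  have -> : D%:R * (2 * b) ^+ 2 = (2 * a) ^+ 2 - 4 * (a ^+ 2 - D%:R * b ^+ 2) by ring.
  by apply: rpredB; [apply: rpredX | apply: rpredM => //; exact: rpred_nat].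
have [T aE] := rat_int_zR aT; have [S bE] := rat_int_zR bS; have [N NE] := rat_int_zR abN.
have key : (T * T - Z.of_nat D * (S * S) = 4 * N)%BZ.
  apply: zR_inj; rewrite !(zRB, zRM) zR_nat zR_4 -aE -bE -NE; ring.
have aE' : a = zR rat T / 2 by rewrite -aE mulrC mulKf.
have bE' : b = zR rat S / 2 by rewrite -bE mulrC mulKf.
have D4 : (D %% 4)%N <> 0%N.
  move=> d0; have : (2 ^ 2 %| D)%N by rewrite /dvdn d0.
  by move/D_sqfree.
have Dd := divn_eq D 4; have Dm := ltn_pmod D (isT : 0 < 4)%N.
have [/eqP d1 | /negbTE d1] := boolP (D %% 4 == 1)%N.
  have [k kE] : exists k, (T - S = 2 * k)%BZ.
    have De : (Z.of_nat D = 4 * Z.of_nat (D %/ 4) + 1)%BZ by lia.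
    exists ((T - S) / 2)%BZ; have := Z.div_mod (T - S) 2; have := Z.mod_pos_bound (T - S) 2.
    move: ((T - S) / 2)%BZ ((T - S) mod 2)%BZ => k r r2 kr.
    have [r0 | r1] : (r = 0 \/ r = 1)%BZ by lia.
      lia.
    have TE : (T = S + 2 * k + 1)%BZ by lia.
    rewrite TE De in key; nia.
  exists (k, S); rewrite quad_phi d1 eqxx /= aE' bE'; congr (ia _ + _).
  rewrite (_ : T = (2 * k + S)%BZ); last by lia.
  by rewrite zRD zRM zR_2; field.
have [k [l [kE lE]]] : exists k l, (T = 2 * k /\ S = 2 * l)%BZ.
  have De : (Z.of_nat D = 4 * Z.of_nat (D %/ 4) + Z.of_nat (D %% 4))%BZ by lia.
  have par (y : Z) : exists k : Z, (y = 2 * k \/ y = 2 * k + 1)%BZ.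
    by exists (y / 2)%BZ; have := Z.div_mod y 2; have := Z.mod_pos_bound y 2; lia.
  have [k kE] := par T; have [l lE] := par S; exists k, l.
  move: key; rewrite {}De; move: (Z.of_nat (D %/ 4)) => j.
  have [-> | ->] : (Z.of_nat (D %% 4) = 2 \/ Z.of_nat (D %% 4) = 3)%BZ by lia.
    by case: kE => ->; case: lE => ->; nia.
  by case: kE => ->; case: lE => ->; nia.
exists (k, l); rewrite quad_phi d1 /= aE' bE' kE lE !zRM zR_2.
by rewrite ![2 * _]mulrC !mulfK.
Qed.

Lemma quad_phi_integer y : ring_of_integers (qphi quad_w y).
Proof.
have wi : integralOver (intr : int -> F) quad_w.
  exists (Poly [:: - int_of_Z quad_n; - int_of_Z quad_t; 1]).
    by rewrite monicE lead_coefE (@PolyK _ 0).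
  rewrite rootE map_polyE (@PolyK _ 0) // horner_Poly /= !rmorphN rmorph1 mul0r add0r mul1r.
  rewrite mulrDl -expr2 quad_w_sq -/(zR F quad_t) -/(zR F quad_n).
  by apply/eqP; ring.
by apply: integral_add; [|apply: integral_mul]; rewrite ?/zR //; apply: integral_id.
Qed.
End QuadraticField.

(** * Certificates and conclusion *)

Section UniversalLattice.
Variables (D : nat) (F : fieldExtType rat) (x : F).
Hypotheses (D_gt1 : (1 < D)%N) (D_sqfree : squarefree D) (x_sq : x ^+ 2 = D%:R).
Hypothesis F_gen : <<1; x>>%VS = fullv.
Local Notation t := (quad_t D).
Local Notation n := (quad_n D).
Local Notation phi := (qphi (quad_w D x)).

Variables (V : vectType F) (Q : V -> F) (L : set V).
Hypotheses (lattL : quadratic_lattice Q L) (univL : universal Q L).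
Variable B : {biscalar V}.
Hypothesis QD : forall u v, Q (u + v) = Q u + Q v + B u v.
Variable U : {vspace V}.
Hypotheses (spanU : field_span L U) (dimU : \dim U = 3%N).

Let w_sq := quad_w_sq D_gt1 x_sq.
Let disc_gt0 := quad_disc_gt0 D_gt1.
Let phi_inj := quad_phi_inj D_gt1 D_sqfree x_sq.
Let phi_integer y : ring_of_integers (phi y) := quad_phi_integer D_gt1 x_sq y.
Let integer_phi := quad_integer_phi D_gt1 D_sqfree x_sq F_gen.

Let QZ a v : Q (a *: v) = a ^+ 2 * Q v.
Proof. by case: lattL => -[]. Qed.

Let LD u v : L u -> L v -> L (u + v).
Proof.
case: lattL => _ [k [e ->]] _ [a ai ->] [b bi ->].
exists (fun i => a i + b i) => [i|]; first by apply: integral_add; [apply: ai | apply: bi].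
by rewrite -big_split; apply: eq_bigr => i _; rewrite scalerDl.
Qed.

Let LZ y v : L v -> L (phi y *: v).
Proof.
case: lattL => _ [k [e ->]] _ [a ai ->].
exists (fun i => phi y * a i) => [i|].
  by apply: integral_mul; [apply: phi_integer | apply: ai].
by rewrite scaler_sumr; apply: eq_bigr => i _; rewrite scalerA.
Qed.

Let Qint v : L v -> exists y, Q v = phi y.
Proof. by case: lattL => _ _ QL Lv; apply: integer_phi; apply: QL; exists v. Qed.

Let Qpos v : L v -> v != 0 -> forall s : {rmorphism F -> algC}, 0 < s (Q v).
Proof. by move=> Lv v0 s; case: univL => /(_ v Lv v0)[_ h] _; apply: h. Qed.

Let Qrep y : tpos t n y -> exists2 v, L v & Q v = phi y.
Proof.
move=> ty; have : totally_positive_integers (phi y).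
  by split; [apply: phi_integer | move=> s; apply: (tpos_sound disc_gt0 w_sq)].
by case: univL => _ <- [v [Lv _] <-]; exists v.
Qed.

Let LU v : L v -> v \in U.
Proof. by case: spanU => h _ /h. Qed.

(** With [basal] constantly false the divisibility tests are vacuous, so L may be any universal
    ternary lattice. *)
Lemma universal_check_absurd a2 planes :
  check t n (fun _ => false) a2 planes -> False.
Proof.
have [s1 [s2 s12]] := quad_w_conj D_gt1 D_sqfree x_sq F_gen.
exact: (check_sound disc_gt0 w_sq s12 phi_inj QZ QD LD LZ Qint Qpos Qrep LU dimU).
Qed.

Lemma universal_large_absurd y r : tpos t n (y, 1)%BZ -> (0 <= r)%BZ ->
  (qnm t n (y, 1)%BZ <= r * r)%BZ -> (160 < t * t + 4 * n)%BZ ->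
  (20 * qtr t (y, 1)%BZ + 40 * r < t * t + 4 * n)%BZ -> False.
Proof.
have [s1 [s2 s12]] := quad_w_conj D_gt1 D_sqfree x_sq F_gen.
exact: (large_disc_absurd disc_gt0 w_sq s12 phi_inj QZ QD LD LZ Qint Qpos Qrep LU dimU).
Qed.

(** For c = a + b x the product of the denominators of a and b works. This turns a linear relation
    over F into one over the integers of F. *)
Lemma clear_denominators (c : F) : exists2 k : nat, (0 < k)%N & ring_of_integers (k%:R * c).
Proof.
have [a [b ->]] := quad_coord x_sq F_gen c.
have xi : integralOver (intr : int -> F) x.
  exists (Poly [:: - D%:Z; 0; 1]); first by rewrite monicE lead_coefE (@PolyK _ 0).
  rewrite rootE map_polyE (@PolyK _ 0) // horner_Poly /= rmorphN rmorph1 rmorph0.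
  by rewrite mul0r add0r mul1r addr0 -expr2 x_sq subr_eq0.
have den q : (`|denq q|%N%:R * q = (numq q)%:~R :> rat).
  by rewrite numqE mulrC pmulrn absz_denq.
exists (`|denq a| * `|denq b|)%N; first by rewrite muln_gt0 !absz_gt0 !denq_neq0.
have kE q r : (`|denq q| * `|denq r|)%N%:R * (q%:A : F) = (numq q * `|denq r|%:Z)%:~R :> F.
  rewrite -(rmorph_nat (in_alg F)) -(rmorph_int (in_alg F)) -(rmorphM (in_alg F)) /=.
  by rewrite natrM intrM -pmulrn -den mulrAC.
rewrite mulrDr mulrA kE mulnC kE; apply: integral_add; first exact: integral_id.
by apply: integral_mul => //; apply: integral_id.
Qed.

Lemma free_lattice_basis : free_lattice L -> exists e1 e2 e3,
  [/\ L e1, L e2, L e3 & forall v, L v ->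
    exists a b c, v = phi a *: e1 + phi b *: e2 + phi c *: e3].
Proof.
case=> k [e [LE fr]].
have Le i : L (e i).
  rewrite LE; exists (fun j => (j == i)%:R) => [j|]; first exact: integral_nat.
  rewrite (bigD1 i) //= eqxx scale1r big1 ?addr0 // => j /negbTE ->.
  by rewrite scale0r.
have fr' : free [tuple e i | i < k].
  apply/freeP => c c0 i.
  have /fin_all_exists[m mP] j : exists m : nat, (0 < m)%N /\ ring_of_integers (m%:R * c j).
    by have [m] := clear_denominators (c j); exists m.
  pose N := (\prod_j m j)%N.
  have N0 : (N%:R : F) != 0.
    have [s1 _] := quad_w_conj D_gt1 D_sqfree x_sq F_gen.
    rewrite -(fmorph_eq0 s1) rmorph_nat pnatr_eq0 -lt0n prodn_gt0 // => j.
    by case: (mP j).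
  have /fr fr0 : forall j, ring_of_integers (N%:R * c j).
    move=> j; rewrite /N (bigD1 j) //= mulnC natrM -mulrA.
    by apply: integral_mul; [exact: integral_nat | apply: (mP j).2].
  have s0 : \sum_(j < k) (N%:R * c j) *: e j = 0.
    rewrite -[RHS](scaler0 _ N%:R) -[in RHS]c0 scaler_sumr; apply: eq_bigr => j _.
    by rewrite scalerA -tnth_nth tnth_mktuple.
  by apply/eqP; have /eqP := fr0 s0 i; rewrite mulf_eq0 (negbTE N0).
(* The family e is independent over F and spans U, the least subspace containing L. *)
have k3 : k = 3%N.
  rewrite -dimU -(size_tuple [tuple e i | i < k]) -(eqP fr'); apply/eqP.
  rewrite eqn_leq; apply/andP; split; apply: dimvS.
    by apply/span_subvP => _ /codomP[i ->]; apply: LU.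
  apply: spanU.2 => v; rewrite LE => -[a _ ->] /=; apply: memv_suml => i _.
  by apply: memvZ; apply: memv_span; apply: codom_f.
subst k; exists (e ord0), (e (lift ord0 ord0)), (e (lift ord0 (lift ord0 ord0))).
split=> // v; rewrite LE => -[a ai ->].
have [a1 E1] := integer_phi (ai ord0).
have [a2 E2] := integer_phi (ai (lift ord0 ord0)).
have [a3 E3] := integer_phi (ai (lift ord0 (lift ord0 ord0))).
exists a1, a2, a3; rewrite !big_ord_recl big_ord0 addr0 addrA.
by rewrite E1 E2 E3.
Qed.

Lemma universal_free_absurd a2 planes : free_lattice L ->
  (forall c, let k := (qnm t n c mod 5)%BZ in (k = 0 \/ k = 1 \/ k = 4)%BZ) ->
  check t n (basal_mod5 t n) a2 planes -> False.
Proof.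
move=> /free_lattice_basis[e1 [e2 [e3 [L1 L2 L3 gen]]]] nm5.
have [s1 [s2 s12]] := quad_w_conj D_gt1 D_sqfree x_sq F_gen.
apply: (check_sound disc_gt0 w_sq s12 phi_inj QZ QD LD LZ Qint Qpos Qrep LU dimU).
move=> u1 u2 u3 h Lu1 Lu2 Lu3 Q1 hE hb.
exact: (free_basal w_sq s1 phi_inj QZ QD LD Qint dimU L1 L2 L3 gen nm5 Lu1 Lu2 Lu3 Q1 hE hb).
Qed.
End UniversalLattice.

Section Certificates.
Local Open Scope Z_scope.

(* Entries (D, (a2, planes)), found by computer search. *)
Definition exceptional : seq (Z * (elt * seq (elt * elt * seq elt))) := [::
   (11, ((10, 3), [:: ((0, 0), (7, 2), [:: (4, 1); (5, 1); (17, 5)]);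
     ((3, 1), (17, 5), [:: (4, 1); (7, 2); (5, 1)])]));
   (14, ((4, - 1), [:: ((0, 0), (15, 4), [:: (4, 1); (5, 0); (21, 5)]);
     ((1, 0), (5, 0), [:: (7, 1); (49, 13); (21, 5); (35, 9)])]));
   (15, ((2, 0), [:: ((0, 0), (4, 1), [:: (8, 2); (12, 3)]);
     ((1, 0), (4, 1), [:: (8, 2)]);
     ((2, 0), (3, 0), [:: (4, 1); (8, 2)])]));
   (19, ((9, 2), [:: ((0, 0), (5, 1), [:: (2, 0)]);
     ((1, 0), (5, - 1), [:: (5, 1); (5, 0)]);
     ((4, 1), (5, 1), [:: (5, - 1)])]));
   (22, ((5, - 1), [:: ((0, 0), (197, 42), [:: (5, 1); (6, 1); (24, 5)]);
     ((1, 0), (24, - 5), [:: (197, 42); (6, 1)])]));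
   (23, ((24, 5), [:: ((0, 0), (5, 1), [:: (5, - 1)]);
     ((5, 1), (5, 1), [:: (5, - 1)])]));
   (26, ((2, 0), [:: ((0, 0), (6, 1), [:: (6, - 1); (11, 2); (7, 1); (10, 1)]);
     ((1, 0), (6, 1), [:: (3, 0); (10, 1)]);
     ((2, 0), (3, 0), [:: (6, 1)])]));
   (29, ((2, 0), [:: ((0, 0), (7, - 2), [:: (3, 1)]);
     ((1, 0), (3, 1), [:: (4, - 1); (5, 2); (12, 5)]);
     ((2, 0), (3, 1), [:: (4, - 1)])]));
   (30, ((11, 2), [:: ((0, 0), (6, 1), [:: (2, 0); (7, 1); (17, 3)])]));
   (31, ((39, 7), [:: ((0, 0), (28, 5), [:: (39, - 7)])]));
   (35, ((2, 0), [:: ((0, 0), (6, 1), [:: (18, 3)]);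
     ((1, 0), (6, 1), [:: (3, 0)]);
     ((2, 0), (6, 1), [:: (12, 2)])]));
   (37, ((3, 1), [:: ((0, 0), (4, - 1), [:: (2, 0); (3, 0)]);
     ((1, 0), (4, - 1), [:: (2, 0)])]));
   (38, ((37, 6), [:: ((0, 0), (56, 9), [:: (7, 1); (8, 1)]);
     ((6, 1), (3, 0), [:: (7, 1)])]));
   (39, ((25, 4), [:: ((0, 0), (13, 2), [:: (2, 0)]);
     ((6, 1), (2, 0), [:: (7, 1)])]));
   (42, ((2, 0), [:: ((0, 0), (7, 1), [:: (13, 2)]);
     ((1, 0), (7, 1), [:: (13, 2); (7, - 1)]);
     ((2, 0), (13, 2), [:: (7, 1)])]));
   (46, ((2, 0), [:: ((0, 0), (7, 1), [:: (7, - 1); (41, 6)]);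
     ((1, 0), (7, 1), [:: (7, - 1)]);
     ((2, 0), (7, 1), [:: (7, - 1)])]));
   (53, ((4, 1), [:: ((0, 0), (2, 0), [:: (5, - 1); (7, 2)]);
     ((1, 0), (9, - 2), [:: (2, 0)])]));
   (55, ((2, 0), [:: ((0, 0), (8, 1), [:: (15, 2); (30, 4)]);
     ((1, 0), (8, 1), [:: (15, 2)]);
     ((2, 0), (15, 2), [:: (15, - 2)])]));
   (57, ((131, 40), [:: ((0, 0), (2, 0), [:: (4, 1)]);
     ((13, 4), (2, 0), [:: (4, 1)])]));
   (61, ((7, 2), [:: ((0, 0), (3, 0), [:: (9, - 2)]);
     ((3, 1), (9, - 2), [:: (2, 0); (133, 39)])]));
   (62, ((63, 8), [:: ((0, 0), (8, 1), [:: (8, - 1)]);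
     ((8, 1), (8, 1), [:: (8, - 1)])]));
   (66, ((2, 0), [:: ((0, 0), (25, 3), [:: (9, 1); (41, 5)]);
     ((1, 0), (3, 0), [:: (9, 1)]);
     ((2, 0), (25, 3), [:: (3, 0)])]));
   (69, ((11, 3), [:: ((0, 0), (4, 1), [:: (5, - 1)]);
     ((4, 1), (4, 1), [:: (5, - 1)])]));
   (70, ((2, 0), [:: ((0, 0), (9, 1), [:: (9, - 1); (17, 2)]);
     ((1, 0), (9, 1), [:: (3, 0)]);
     ((2, 0), (17, 2), [:: (9, 1)])]));
   (73, ((4, 1), [:: ((0, 0), (24, - 5), [:: (5, - 1)])]));
   (78, ((53, 6), [:: ((0, 0), (9, 1), [:: (9, - 1)]);
     ((9, 1), (9, 1), [:: (9, - 1)])]));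
   (85, ((2, 0), [:: ((0, 0), (5, 1), [:: (6, - 1); (13, 3)]);
     ((1, 0), (5, 1), [:: (3, 0); (13, 3); (38, 9)]);
     ((2, 0), (3, 0), [:: (5, 1)])]));
   (89, ((2, 0), [:: ((0, 0), (17, 4), [:: (21, - 4)]);
     ((1, 0), (3, 0), [:: (17, 4)]);
     ((2, 0), (17, 4), [:: (21, - 4)])]));
   (91, ((2, 0), [:: ((0, 0), (10, 1), [:: (10, - 1); (39, 4)]);
     ((1, 0), (3, 0), [:: (10, 1)]);
     ((2, 0), (3, 0), [:: (10, 1)])]));
   (93, ((13, 3), [:: ((0, 0), (5, 1), [:: (2, 0)]);
     ((4, 1), (5, 1), [:: (2, 0)])]));
   (94, ((2, 0), [:: ((0, 0), (10, 1), [:: (10, - 1); (49, 5)]);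
     ((1, 0), (10, 1), [:: (10, - 1)]);
     ((2, 0), (39, 4), [:: (10, - 1)])]));
   (105, ((2, 0), [:: ((0, 0), (37, 8), [:: (5, 1); (19, 4)]);
     ((1, 0), (37, 8), [:: (5, 1); (3, 0)]);
     ((2, 0), (37, 8), [:: (5, 1)])]));
   (110, ((2, 0), [:: ((0, 0), (21, 2), [:: (42, 4)]);
     ((1, 0), (21, 2), [:: (42, 4)]);
     ((2, 0), (21, 2), [:: (42, 4)])]));
   (133, ((16, 3), [:: ((0, 0), (7, - 1), [:: (2, 0); (3, 0); (27, 5)]);
     ((5, 1), (32, - 5), [:: (2, 0); (3, 0)])]));
   (161, ((2, 0), [:: ((0, 0), (6, 1), [:: (7, - 1); (30, 5)]);
     ((1, 0), (6, 1), [:: (7, - 1)]);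
     ((2, 0), (6, 1), [:: (7, - 1)])]));
   (217, ((2, 0), [:: ((0, 0), (7, 1), [:: (8, - 1); (21, 3)]);
     ((1, 0), (7, 1), [:: (8, - 1)]);
     ((2, 0), (7, 1), [:: (8, - 1)])]));
   (253, ((2, 0), [:: ((0, 0), (15, 2), [:: (17, - 2); (38, 5)]);
     ((1, 0), (15, 2), [:: (17, - 2)]);
     ((2, 0), (15, 2), [:: (17, - 2)])]));
   (273, ((2, 0), [:: ((0, 0), (8, 1), [:: (16, 2); (47, 6)]);
     ((1, 0), (3, 0), [:: (8, 1)]);
     ((2, 0), (16, 2), [:: (8, 1)])]));
   (329, ((2, 0), [:: ((0, 0), (9, 1), [:: (10, - 1); (35, 4)]);
     ((1, 0), (9, 1), [:: (10, - 1)]);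
     ((2, 0), (9, 1), [:: (10, - 1)])]));
   (341, ((2, 0), [:: ((0, 0), (9, 1), [:: (10, - 1); (44, 5)]);
     ((1, 0), (9, 1), [:: (10, - 1)]);
     ((2, 0), (35, 4), [:: (10, - 1)])]));
   (385, ((2, 0), [:: ((0, 0), (19, 2), [:: (28, 3)]);
     ((1, 0), (19, 2), [:: (28, 3); (3, 0)]);
     ((2, 0), (19, 2), [:: (28, 3)])]));
   (429, ((2, 0), [:: ((0, 0), (20, 2), [:: (10, 1)]);
     ((1, 0), (20, 2), [:: (10, 1)]);
     ((2, 0), (10, 1), [:: (11, - 1)])]));
   (465, ((2, 0), [:: ((0, 0), (21, 2), [:: (31, 3)]);
     ((1, 0), (3, 0), [:: (31, 3)]);
     ((2, 0), (3, 0), [:: (31, 3)])]));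
   (741, ((2, 0), [:: ((0, 0), (27, 2), [:: (5, 0)]);
     ((1, 0), (14, 1), [:: (3, 0)]);
     ((2, 0), (3, 0), [:: (14, 1)])]))].

(* Here (x, 1) is the least totally positive element of w + Z. *)
Definition generic (t n : Z) : elt * seq (elt * elt * seq elt) :=
  let f := Z.sqrt (t * t + 4 * n) in
  let x := if t =? 0 then f / 2 + 1 else (f + 1) / 2 in
  let ts := [:: (x, 1); (x + t, - 1); (x + 1, 1); (x + 2, 1); (x + 3, 1); (x + 4, 1); (x + 5, 1)] in
  ((2, 0), [:: ((0, 0), (5, 0), ts); ((1, 0), (3, 0), ts); ((2, 0), (3, 0), ts)]).

Fixpoint lookup (D : Z) (l : seq (Z * (elt * seq (elt * elt * seq elt)))) :=
  if l is (D', c) :: l' then if D =? D' then Some c else lookup D l' else None.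

Definition quad_params (D : Z) : Z * Z := if D mod 4 =? 1 then (1, D / 4) else (0, D).

Definition excluded (D : Z) : bool :=
  let: (t, n) := quad_params D in
  let c := if lookup D exceptional is Some c then c else generic t n in
  check t n (fun _ => false) c.1 c.2.

Definition admissible : seq Z := [:: 2; 3; 5; 6; 7; 10; 13; 17; 21; 33; 41; 65; 77].

(** These are the primes below 31, and the search concerns only D < 961 = 31^2. *)
Definition square_factor (D : Z) : bool :=
  has (fun d => D mod (d * d) =? 0) [:: 2; 3; 5; 7; 11; 13; 17; 19; 23; 29].

Definition settled (D : Z) : bool :=
  if has (Z.eqb D) admissible then true else if square_factor D then true else excluded D.

Definition certificate10 : elt * seq (elt * elt * seq elt) :=
   ((4, - 1), [:: ((- 2, 1), (10, 3), [:: (5, 1); (5, - 1)]);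
     ((0, 0), (2, 0), [:: (4, 1); (10, 3); (11, - 3)]);
     ((1, 0), (2, 0), [:: (4, 1); (10, 3); (5, 1)])]).

Definition certificate65 : elt * seq (elt * elt * seq elt) :=
   ((2, 0), [:: ((0, 0), (4, 1), [:: (5, - 1); (11, 3); (18, 5)]);
     ((1, 0), (4, 1), [:: (5, - 1); (11, 3); (3, 0); (8, 2)]);
     ((2, 0), (11, 3), [:: (4, 1)])]).
End Certificates.

(** * Evaluation of the search *)

Lemma settled_2_60 : all settled (zrange 2 60).
(* The evaluation is left to the kernel, which performs it at [Qed]. *)
Proof. exact_no_check (erefl true). Qed.

Lemma settled_61_120 : all settled (zrange 61 120).
Proof. exact_no_check (erefl true). Qed.

Lemma settled_121_224 : all settled (zrange 121 224).
Proof. exact_no_check (erefl true). Qed.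

Lemma settled_225_957 : all (fun k => settled (4 * k + 1)%BZ) (zrange 56 239).
Proof. exact_no_check (erefl true). Qed.

Lemma check10 : check 0 10 (basal_mod5 0 10) certificate10.1 certificate10.2.
Proof. exact_no_check (erefl true). Qed.

Lemma check65 : check 1 16 (basal_mod5 1 16) certificate65.1 certificate65.2.
Proof. exact_no_check (erefl true). Qed.

Lemma quad_paramsE D : quad_params (Z.of_nat D) = (quad_t D, quad_n D).
Proof.
have DE : Z.of_nat D = (4 * Z.of_nat (D %/ 4) + Z.of_nat (D %% 4))%BZ by lia.
have D4 := ltn_pmod D (isT : 0 < 4)%N.
have modE : (Z.of_nat D mod 4)%BZ = Z.of_nat (D %% 4).
  by symmetry; apply: (Z.mod_unique_pos _ _ (Z.of_nat (D %/ 4))); lia.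
have divE : (Z.of_nat D / 4)%BZ = Z.of_nat (D %/ 4).
  by symmetry; apply: (Z.div_unique_pos _ _ _ (Z.of_nat (D %% 4))); lia.
rewrite /quad_params /quad_t /quad_n modE divE.
have -> : (Z.of_nat (D %% 4) =? 1)%BZ = (D %% 4 == 1)%N by lia.
by case: ifP.
Qed.

Lemma settled_small (D : nat) : (1 < D)%N ->
  (D <= 224)%N || ((D %% 4 == 1)%N && (D <= 960)%N) -> settled (Z.of_nat D).
Proof.
move=> D1 Dle; have [D60 | D60] := leqP D 60.
  by apply: (allP settled_2_60); apply: mem_zrange; lia.
have [D120 | D120] := leqP D 120.
  by apply: (allP settled_61_120); apply: mem_zrange; lia.
have [D224 | D224] := leqP D 224.
  by apply: (allP settled_121_224); apply: mem_zrange; lia.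
have -> : Z.of_nat D = (4 * Z.of_nat (D %/ 4) + 1)%BZ by lia.
by apply: (allP settled_225_957 (Z.of_nat (D %/ 4))); apply: mem_zrange; lia.
Qed.

Lemma square_factor_not_squarefree (D : nat) :
  square_factor (Z.of_nat D) -> ~ squarefree D.
Proof.
case/hasP => d dl /Z.eqb_spec dm sqf.
have /allP/(_ d dl)/Z.leb_spec0 d2 :
  all (fun d => 2 <=? d)%BZ [:: 2; 3; 5; 7; 11; 13; 17; 19; 23; 29]%BZ by [].
have dd0 : (d * d <> 0)%BZ by nia.
have dE := Z.div_mod (Z.of_nat D) (d * d) dd0; rewrite dm Z.add_0_r in dE.
have /sqf : (Z.to_nat d ^ 2 %| D)%N; last by lia.
apply/dvdnP; exists (Z.to_nat (Z.of_nat D / (d * d))); rewrite -mulnn.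
have q0 : (0 <= Z.of_nat D / (d * d))%BZ by apply: Z.div_pos; nia.
apply: Nat2Z.inj; rewrite [LHS]dE.
have -> (a b : nat) : Z.of_nat (a * (b * b))%N = (Z.of_nat a * (Z.of_nat b * Z.of_nat b))%BZ by lia.
rewrite !Z2Nat.id //; lia.
Qed.

(** With k the integer part of the square root of D and y the least integer making y + w totally
    positive, N(y + w) is at most k + 1 if D = 1 mod 4 and 2k + 1 otherwise; r exceeds the integer
    square root of k or 2k + 1 by 1. The last inequality holds from k = 31 or k = 15 on, whence 961
    = 31^2 and 225 = 15^2. *)
Lemma large_parameters (D : nat) : (225 <= D)%N -> ((D %% 4)%N = 1%N -> (961 <= D)%N) ->
  exists y r, let t := quad_t D in let n := quad_n D in
  [/\ tpos t n (y, 1)%BZ, (0 <= r)%BZ, (qnm t n (y, 1)%BZ <= r * r)%BZ,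
      (160 < t * t + 4 * n)%BZ & (20 * qtr t (y, 1)%BZ + 40 * r < t * t + 4 * n)%BZ].
Proof.
move=> D225 D961; pose k := Z.sqrt (Z.of_nat D).
have [kl ku] := Z.sqrt_spec (Z.of_nat D) (Nat2Z.is_nonneg D); rewrite -/k in kl ku.
have k0 := Z.sqrt_nonneg (Z.of_nat D); rewrite -/k in k0.
rewrite /quad_t /quad_n; have [d1 | d1] := boolP (D %% 4 == 1)%N.
  have D4 : (Z.of_nat D = 4 * Z.of_nat (D %/ 4) + 1)%BZ by lia.
  have D9 : (961 <= Z.of_nat D)%BZ by have := D961 (eqP d1); lia.
  have k31 : (31 <= k)%BZ by nia.
  pose s := Z.sqrt k; have [sl su] := Z.sqrt_spec k k0; rewrite -/s in sl su.
  have s0 := Z.sqrt_nonneg k; rewrite -/s in s0.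
  pose y := ((k + 1) / 2)%BZ.
  have yk : (2 * y = k \/ 2 * y = k + 1)%BZ.
    by rewrite /y; have := Z.div_mod (k + 1) 2; have := Z.mod_pos_bound (k + 1) 2; lia.
  exists y, (s + 1)%BZ; rewrite /tpos /qtr /qnm /=; move: D4 D9 kl ku.
  move: (Z.of_nat (D %/ 4)) => j -> D9 kl ku; split.
  - by apply/andP; split; apply/Z.ltb_spec0; nia.
  - lia.
  - nia.
  - lia.
  (* For small s the bound k >= 31 suffices; for larger s, s^2 <= k makes k larger. *)
  - have [s5 | s6] : (s <= 5 \/ 6 <= s)%BZ by lia.
      nia.
    nia.
have D2 : (225 <= Z.of_nat D)%BZ by lia.
have k15 : (15 <= k)%BZ by nia.
pose s := Z.sqrt (2 * k + 1); have [|sl su] := Z.sqrt_spec (2 * k + 1); first lia.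
have s0 := Z.sqrt_nonneg (2 * k + 1); rewrite -/s in s0 sl su.
exists (k + 1)%BZ, (s + 1)%BZ; rewrite /tpos /qtr /qnm /=; move: D2 kl ku.
move: (Z.of_nat D) => d D2 kl ku; split.
- by apply/andP; split; apply/Z.ltb_spec0; nia.
- lia.
- nia.
- lia.
- have [s5 | [s6 | s7]] : (s <= 5 \/ s = 6 \/ 7 <= s)%BZ by lia.
  + nia.
  + nia.
  + nia.
Qed.

(** The norm x^2 - 10 y^2 is a square mod 5. *)
Lemma qnm10_mod5 (c : elt) (k := (qnm 0 10 c mod 5)%BZ) : (k = 0 \/ k = 1 \/ k = 4)%BZ.
Proof.
case: c @k => x y; rewrite /qnm /=.
have := Z.div_mod x 5; have := Z.mod_pos_bound x 5.
move: (x / 5)%BZ (x mod 5)%BZ => j r rb xE.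
have -> : (x * x + 0 * (x * y) - 10 * (y * y) =
    r * r + (5 * (j * j) + 2 * (j * r) - 2 * (y * y)) * 5)%BZ.
  by rewrite xE; lia.
rewrite Z.mod_add //.
have : (r = 0 \/ r = 1 \/ r = 2 \/ r = 3 \/ r = 4)%BZ by lia.
by case=> [|[|[|[|]]]] ->; vm_compute; lia.
Qed.

(** Four times the norm is (2x + y)^2 - 65 y^2, so the norm is a square mod 5. *)
Lemma qnm65_mod5 (c : elt) (k := (qnm 1 16 c mod 5)%BZ) : (k = 0 \/ k = 1 \/ k = 4)%BZ.
Proof.
case: c @k => x y; rewrite /qnm /=.
have := Z.div_mod x 5; have := Z.mod_pos_bound x 5.
have := Z.div_mod y 5; have := Z.mod_pos_bound y 5.
move: (x / 5)%BZ (x mod 5)%BZ (y / 5)%BZ (y mod 5)%BZ => j r l s sb yE rb xE.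
have -> : (x * x + 1 * (x * y) - 16 * (y * y) = r * r + r * s - 16 * (s * s) +
   (5 * (j * j) + 2 * (j * r) + 5 * (j * l) + j * s + l * r - 80 * (l * l) - 32 * (l * s)) * 5)%BZ.
  by rewrite xE // yE //; lia.
rewrite Z.mod_add //.
have : (r = 0 \/ r = 1 \/ r = 2 \/ r = 3 \/ r = 4)%BZ by lia.
have : (s = 0 \/ s = 1 \/ s = 2 \/ s = 3 \/ s = 4)%BZ by lia.
by case=> [|[|[|[|]]]] ->; case=> [|[|[|[|]]]] ->; vm_compute; lia.
Qed.

Theorem theorem7p1 (D : nat) (D_gt1 : (1 < D)%N) (D_sqfree : squarefree D)
    (F : fieldExtType rat) (sqrtD : F) (sqrtD_sq : sqrtD ^+ 2 = D%:R)
    (F_gen : <<1; sqrtD>>%VS = fullv) :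
  ((exists (V : vectType F) (Q : V -> F) (L : set V),
      [/\ quadratic_lattice Q L, ternary L & universal Q L]) ->
    D \in [:: 2; 3; 5; 6; 7; 10; 13; 17; 21; 33; 41; 65; 77]%N) /\
  (D = 10%N \/ D = 65%N ->
    ~ exists (V : vectType F) (Q : V -> F) (L : set V),
        [/\ quadratic_lattice Q L, ternary L, free_lattice L & universal Q L]).
Proof.
split=> [[V [Q [L [lattL [U spanU dimU] univL]]]] |
         D_cases [V [Q [L [lattL [U spanU dimU] freeL univL]]]]].
  have [B QD] : exists B : {biscalar V}, forall u v, Q (u + v) = Q u + Q v + B u v.
    by case: lattL => -[].
  (* The evaluated search covers the small D; beyond them rationality of the pairings gives the
     contradiction. *)
  have [small | large] := boolP ((D <= 224)%N || ((D %% 4 == 1)%N && (D <= 960)%N)).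
    have := settled_small D_gt1 small; rewrite /settled.
    case: ifP => [adm _ | _]; first by move: adm; rewrite /= !inE; lia.
    case: ifP => [/square_factor_not_squarefree // | _].
    rewrite /excluded quad_paramsE.
    by move/(universal_check_absurd D_gt1 D_sqfree sqrtD_sq F_gen lattL univL QD spanU dimU).
  have [||y [r [h1 h2 h3 h4 h5]]] := @large_parameters D; [lia | lia |].
  by case: (universal_large_absurd D_gt1 D_sqfree sqrtD_sq F_gen lattL univL QD spanU dimU
    h1 h2 h3 h4 h5).
have [B QD] : exists B : {biscalar V}, forall u v, Q (u + v) = Q u + Q v + B u v.
  by case: lattL => -[].
have absurd := universal_free_absurd D_gt1 D_sqfree sqrtD_sq F_gen lattL univL QD spanU dimU.
case: D_cases => DE; rewrite DE in absurd.
  exact: (absurd _ _ freeL qnm10_mod5 check10).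
exact: (absurd _ _ freeL qnm65_mod5 check65).
Qed.
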